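(* Let $\mathfrak g=\mathfrak{sp}(2r)$, $r\geq3$, let $\lambda$ be a dominant integral weight, $\boldsymbol\Lambda=(\lambda,\omega_1)$, $\boldsymbol z=(0,1)$, and let $\boldsymbol l$ be an admissible $r$-tuple of length $l$. Let the $r$-tuple $\boldsymbol y$ represent the solution of the Bethe ansatz equation associated to $\boldsymbol\Lambda,\boldsymbol z,\boldsymbol l$. Then $$D_\lambda(\boldsymbol y)=D_\lambda\big(x^{a_\lambda^l(1)},\dots,x^{a_\lambda^l(r)}\big).$$
   Context: Type $\mathrm C_r$ conventions: simple roots $\alpha_1,\dots,\alpha_r$ (standard numbering), coroots $\alpha_i^\vee$, fundamental weights $\omega_i$; $(\alpha_i,\alpha_i)=2$ for $i<r$, $(\alpha_r,\alpha_r)=4$; $\lambda_i=\langle\lambda,\alpha_i^\vee\rangle$. Bethe ansatz equation. Given weights $\boldsymbol\Lambda=(\Lambda_1,\dots,\Lambda_n)$, distinct complex numbers $\boldsymbol z$ and nonnegative integers $\boldsymbol l=(l_1,\dots,l_r)$ with $l=\sum l_i$, let $c:\{1,\dots,l\}\to\{1,\dots,r\}$ be non-decreasing with $\#c^{-1}(i)=l_i$. The equation is $$-\sum_{s=1}^n\frac{(\alpha_{c(i)},\Lambda_s)}{t_i-z_s}+\sum_{j\ne i}\frac{(\alpha_{c(i)},\alpha_{c(j)})}{t_i-t_j}=0,\quad i=1,\dots,l$$ (terms with zero numerator omitted, other denominators nonzero; solutions are considered up to permutations preserving $c$). A solution is represented by $\boldsymbol y=(y_1,\dots,y_r)$, $y_i=\prod_{c(j)=i}(x-t_j)$.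 The tuple $\boldsymbol l$ is admissible if $V_{\lambda+\omega_1-\sum l_i\alpha_i}$ is a summand of $V_\lambda\otimes V_{\omega_1}$. Admissible tuples have the form $(1,\dots,1,0,\dots,0)$ (with $k_1$ ones, $0\leq k_1\leq r$) or $(1,\dots,1,2,\dots,2,1)$ (with $k_2$ ones in front, $0\leq k_2\leq r-2$) and are determined by their length $l\in\{0,\dots,2r-1\}$; such a tuple of length $l$ is admissible iff $l=0$, or $1\leq l\leq r$ and $\lambda_l>0$, or $r<l\leq2r-1$ and $\lambda_{2r-l}>0$. For admissible tuples the Bethe ansatz equation with these data has exactly one solution. Differential operator. Let $T_1=x^{\lambda_1}(x-1)$ and $T_i=x^{\lambda_i}$ for $2\leq i\leq r$. Put $\partial=d/dx$, $\ln'f=f'/f$. For an $r$-tuple $\boldsymbol y$ of quasi-polynomials (functions $x^ap(x)$ with $a\in\mathbb C$, $p\in\mathbb C[x]$), put $Y_0=1$, $Y_i=y_i$ for $1\leq i\leq r-1$, $Y_r=y_r^2$, and define the order $2r+1$ operator $$D_\lambda(\boldsymbol y)=\overrightarrow{\prod_{i=1}^{r}}\Big(\partial-\ln'\frac{Y_{i-1}\,T_1^2\cdots T_r^2}{Y_i\,T_1\cdots T_{i-1}}\Big)\cdot\big(\partial-\ln'(T_1\cdots T_r)\big)\cdot\overrightarrow{\prod_{i=r,r-1,\dots,1}}\Big(\partial-\ln'\frac{Y_i\,T_1\cdots T_{i-1}}{Y_{i-1}}\Big),$$ where factors are ordered left to right with $i=1,2,\dots,r$ in the first product and $i=r,r-1,\dots,1$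 in the last (so the last factor is $\partial-\ln'y_1$). Exponents. For $0\leq l\leq r-1$: $a_\lambda^l(i)=\lambda_i+\dots+\lambda_l+l+1-i$ for $1\leq i\leq l$, and $a_\lambda^l(i)=0$ for $l+1\leq i\leq r$. For $l=r$: $a_\lambda^r(i)=\lambda_i+\dots+\lambda_{r-1}+2\lambda_r+r+2-i$ for $1\leq i\leq r-1$, and $a_\lambda^r(r)=\lambda_r+1$. For $r+1\leq l\leq2r-1$, with $k=2r-l-1$: $a_\lambda^l(i)=\lambda_i+\dots+\lambda_k+2\lambda_{k+1}+\dots+2\lambda_r+2r+1-k-i$ for $1\leq i\leq k$; $a_\lambda^l(i)=2\lambda_{k+1}+\dots+2\lambda_r+2r-2k$ for $k+1\leq i\leq r-1$; and $a_\lambda^l(r)=\lambda_{k+1}+\dots+\lambda_r+r-k$. *)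

(* Defs.v *)
From mathcomp Require Import all_boot all_order all_algebra.
From mathcomp Require Import fraction generic_quotient.
From mathcomp Require Export reals complex mxtens.

Set Implicit Arguments.
Unset Strict Implicit.
Unset Printing Implicit Defensive.

Import Order.TTheory GRing.Theory Num.Theory.
Local Open Scope ring_scope.

(* Indices 1, ..., r are kept as natural numbers: an r-tuple is a function on
   nat of which only the values at 1, ..., r matter. *)

(* The root system C_r is realized in Z^r with the standard scalar product:
   alpha_i = eps_i - eps_(i+1) for i < r, alpha_r = 2 eps_r, so that
   (alpha_i, alpha_i) = 2 for i < r and (alpha_r, alpha_r) = 4. The weight
   lattice of sp(2r) is the whole of Z^r, with omega_i = eps_1 + ... + eps_i. *)
Notation weight r := 'rV[int]_r.

Definition eps (r i : nat) : weight r := \row_(j < r) (j.+1 == i)%:R.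

Definition wdot (r : nat) (u v : weight r) : int := \sum_(j < r) u 0 j * v 0 j.

Definition sroot (r i : nat) : weight r :=
  if i == r then eps r r *+ 2 else eps r i - eps r i.+1.

(* alpha_i^vee = 2 alpha_i / (alpha_i, alpha_i) *)
Definition scoroot (r i : nat) : weight r :=
  if i == r then eps r r else eps r i - eps r i.+1.

Definition fweight (r i : nat) : weight r := \sum_(1 <= j < i.+1) eps r j.

Definition dominant (r : nat) (lam : weight r) : Prop :=
  forall i : nat, (1 <= i <= r)%N -> 0 <= wdot lam (scoroot r i).

(* lambda_i = <lambda, alpha_i^vee>; only used for dominant lambda, where the
   absolute value does nothing but turn a nonnegative integer into a nat. *)
Definition label (r : nat) (lam : weight r) (i : nat) : nat :=
  `|wdot lam (scoroot r i)|%N.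

(* sp(2r) consists of the matrices X with X^T J + J X = 0, that is of the
   block matrices (A, B; C, - A^T) with B and C symmetric. *)
Definition Jmx (K : fieldType) (r : nat) : 'M[K]_(r + r) :=
  block_mx 0 1%:M (- 1%:M) 0.

Definition in_sp (K : fieldType) (r : nat) (X : 'M[K]_(r + r)) : Prop :=
  X^T *m Jmx K r + Jmx K r *m X = 0.

Definition lie_br (K : fieldType) (n : nat) (X Y : 'M[K]_n) : 'M[K]_n :=
  X *m Y - Y *m X.

Definition unit_mx (K : fieldType) (r i j : nat) : 'M[K]_r :=
  \matrix_(a < r, b < r) ((a.+1 == i) && (b.+1 == j))%:R.

(* The Cartan subalgebra, on which eps_j takes the value a 0 j. *)
Definition cartan (K : fieldType) (r : nat) (a : 'rV[K]_r) : 'M[K]_(r + r) :=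
  block_mx (diag_mx a) 0 0 (- diag_mx a).

Definition weight_at (K : fieldType) (r : nat) (lam : weight r) (a : 'rV[K]_r)
    : K :=
  \sum_(j < r) (lam 0 j)%:~R * a 0 j.

(* The root vector of the simple root alpha_i. *)
Definition raising (K : fieldType) (r i : nat) : 'M[K]_(r + r) :=
  if i == r then block_mx 0 (unit_mx K r r r) 0 0
  else block_mx (unit_mx K r i i.+1) 0 0 (- unit_mx K r i.+1 i).

(* A module K^n (column vectors) is given by a linear map rho; only the values
   of rho on sp(2r) matter. *)
Definition sp_module (K : fieldType) (r n : nat) (rho : 'M[K]_(r + r) -> 'M[K]_n)
    : Prop :=
  [/\ forall (a : K) (X Y : 'M[K]_(r + r)), in_sp X -> in_sp Y ->
        rho (a *: X + Y) = a *: rho X + rho Y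
    & forall X Y : 'M[K]_(r + r), in_sp X -> in_sp Y ->
        rho (lie_br X Y) = lie_br (rho X) (rho Y)].

Definition sp_irreducible (K : fieldType) (r n : nat)
    (rho : 'M[K]_(r + r) -> 'M[K]_n) : Prop :=
  (0 < n)%N /\
  forall U : {vspace 'cV[K]_n},
    (forall (X : 'M[K]_(r + r)) (v : 'cV[K]_n),
       in_sp X -> v \in U -> rho X *m v \in U) ->
    U = 0%VS \/ U = fullv.

Definition highest_weight (K : fieldType) (r n : nat)
    (rho : 'M[K]_(r + r) -> 'M[K]_n) (lam : weight r) : Prop :=
  exists v : 'cV[K]_n,
    [/\ v != 0,
        forall i : nat, (1 <= i <= r)%N -> rho (raising K r i) *m v = 0
      & forall a : 'rV[K]_r, rho (cartan a) *m v = weight_at lam a *: v].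

(* rho is (a model of) V_lambda. *)
Definition is_V (K : fieldType) (r n : nat) (lam : weight r)
    (rho : 'M[K]_(r + r) -> 'M[K]_n) : Prop :=
  [/\ sp_module rho, sp_irreducible rho & highest_weight rho lam].

Definition tensor_rep (K : fieldType) (r n1 n2 : nat)
    (rho1 : 'M[K]_(r + r) -> 'M[K]_n1) (rho2 : 'M[K]_(r + r) -> 'M[K]_n2)
    (X : 'M[K]_(r + r)) : 'M[K]_(n1 * n2) :=
  rho1 X *t 1%:M + 1%:M *t rho2 X.

Definition is_summand (K : fieldType) (r m n : nat)
    (sigma : 'M[K]_(r + r) -> 'M[K]_m) (tau : 'M[K]_(r + r) -> 'M[K]_n) : Prop :=
  exists (inj : 'M[K]_(n, m)) (proj : 'M[K]_(m, n)),
    [/\ proj *m inj = 1%:M,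
        forall X : 'M[K]_(r + r), in_sp X -> tau X *m inj = inj *m sigma X
      & forall X : 'M[K]_(r + r), in_sp X -> proj *m tau X = sigma X *m proj].

(* V_mu is a summand of V_lam (x) V_nu; it does not matter which models of the
   three modules are taken, as they are unique up to isomorphism. *)
Definition V_summand (K : fieldType) (r : nat) (mu lam nu : weight r) : Prop :=
  exists (n1 n2 m : nat) (rho1 : 'M[K]_(r + r) -> 'M[K]_n1)
         (rho2 : 'M[K]_(r + r) -> 'M[K]_n2) (sigma : 'M[K]_(r + r) -> 'M[K]_m),
    [/\ is_V lam rho1, is_V nu rho2, is_V mu sigma
      & is_summand sigma (tensor_rep rho1 rho2)].

Definition admissible (K : fieldType) (r : nat) (lam : weight r)
    (l : nat -> nat) : Prop :=
  V_summand K
    (lam + fweight r 1 - \sum_(1 <= i < r.+1) sroot r i *+ l i) lam (fweight r 1).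

Definition tuple_length (r : nat) (l : nat -> nat) : nat :=
  (\sum_(1 <= i < r.+1) l i)%N.

Definition coloring (r : nat) (l : nat -> nat)
    (c : 'I_(tuple_length r l) -> nat) : Prop :=
  [/\ forall j, (1 <= c j <= r)%N,
      forall j k : 'I_(tuple_length r l), (j <= k)%N -> (c j <= c k)%N
    & forall i : nat, (1 <= i <= r)%N -> #|[set j | c j == i]| = l i].

(* Terms with zero numerator vanish whatever the denominator, as 0 / 0 = 0. *)
Definition bethe_solution (K : fieldType) (r n L : nat)
    (Lam : 'I_n -> weight r) (z : 'I_n -> K) (c : 'I_L -> nat) (t : 'I_L -> K)
    : Prop :=
  [/\ forall i s, wdot (sroot r (c i)) (Lam s) != 0 -> t i != z s,
      forall i j, j != i -> wdot (sroot r (c i)) (sroot r (c j)) != 0 ->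
        t i != t j
    & forall i,
        - (\sum_(s < n) (wdot (sroot r (c i)) (Lam s))%:~R / (t i - z s))
        + \sum_(j < L | j != i)
            (wdot (sroot r (c i)) (sroot r (c j)))%:~R / (t i - t j) = 0].

Definition bethe_poly (K : fieldType) (L : nat) (c : 'I_L -> nat)
    (t : 'I_L -> K) (i : nat) : {poly K} :=
  \prod_(j < L | c j == i) ('X - (t j)%:P).

Notation ratfun K := {fraction {poly K}}.

Definition ratX (K : fieldType) : ratfun K := FracField.tofrac 'X.

(* d/dx on K(x), by the quotient rule. *)
Definition fderiv (K : fieldType) (f : ratfun K) : ratfun K :=
  let p : {poly K} := \n_(repr f) in let q : {poly K} := \d_(repr f) in
  FracField.tofrac (p^`() * q - p * q^`()) / FracField.tofrac (q ^+ 2).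

Definition lnd (K : fieldType) (f : ratfun K) : ratfun K := fderiv f / f.

(* The differential operator \sum_k a_k d^k, with coefficients on the left, is
   represented by the polynomial \sum_k a_k 'X^k. The product of operators is
   dmul, not the commutative product of polynomials. *)
Notation diffop K := {poly (ratfun K)}.

(* d * Q, by Leibniz's rule d a = a d + a' *)
Definition dmul_d (K : fieldType) (Q : diffop K) : diffop K :=
  'X * Q + map_poly (@fderiv K) Q.

Definition dmul (K : fieldType) (P Q : diffop K) : diffop K :=
  \sum_(k < size P) P`_k *: iter k (@dmul_d K) Q.

Definition dfactor (K : fieldType) (f : ratfun K) : diffop K := 'X - f%:P.

Definition Tfun (K : fieldType) (r : nat) (lam : weight r) (i : nat)
    : ratfun K :=
  ratX K ^+ label lam i * (if i == 1%N then ratX K - 1 else 1).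

Definition Yfun (K : fieldType) (r : nat) (y : nat -> ratfun K) (i : nat)
    : ratfun K :=
  if i == 0%N then 1 else if i == r then y r ^+ 2 else y i.

Definition Tprod (K : fieldType) (r : nat) (lam : weight r) (i : nat)
    : ratfun K :=
  \prod_(1 <= j < i.+1) Tfun K lam j.

(* For dominant integral lambda all the quasi-polynomials that occur lie in
   K(x), so the entries of y are taken there. *)
Definition Dop (K : fieldType) (r : nat) (lam : weight r) (y : nat -> ratfun K)
    : diffop K :=
  let Y := Yfun r y in
  let T := Tprod K lam in
  dmul
    (\big[@dmul K/1]_(1 <= i < r.+1)
       dfactor (lnd (Y i.-1 * T r ^+ 2 / (Y i * T i.-1))))
    (dmul (dfactor (lnd (T r)))
       (\big[@dmul K/1]_(i <- rev (index_iota 1 r.+1))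
          dfactor (lnd (Y i * T i.-1 / Y i.-1)))).

(* a_lambda^l(i), for 1 <= i <= r and l <= 2r - 1 *)
Definition expo (r : nat) (lam : weight r) (l i : nat) : nat :=
  let S (a b : nat) := (\sum_(a <= j < b.+1) label lam j)%N in
  if (l < r)%N then
    if (i <= l)%N then (S i l + l + 1 - i)%N else 0%N
  else if l == r then
    if (i < r)%N then (S i r.-1 + 2 * label lam r + r + 2 - i)%N
    else (label lam r + 1)%N
  else
    let k := (2 * r - l - 1)%N in
    if (i <= k)%N then (S i k + 2 * S k.+1 r + 2 * r + 1 - k - i)%N
    else if (i < r)%N then (2 * S k.+1 r + 2 * r - 2 * k)%N
    else (S k.+1 r + r - k)%N.

(* Main.v *)
(* The operator [D_lambda(y)] does not change when one entry [y_i] is replaced by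
   a solution [z] of [y_i z' - y_i' z = const * T_i Y_(i-1) Y_(i+1)] (without
   [Y_(i+1)] for [i = r]), because the product of the consecutive factors that
   involve [y_i] does not change. The Bethe equations guarantee that such a
   rational [z] exists. Choosing [z] of the highest possible order at 0, one
   replaces the entries in the directions [m - 1, .., 1] if the weight
   [lambda + omega_1 - sum_i l_i alpha_i] is [lambda + eps_m], and in the
   directions [m, .., r, .., 1] if it is [lambda - eps_m]. Every step lowers by
   one the degree of the part of the entry that is not a power of [x], and at the
   end all entries are powers of [x].

   Admissibility is only needed to know that the weight has one of these two
   forms; the positivity of the labels follows from the existence of a solution
   of the Bethe equations. *)
Require Import Defs.
From HB Require Import structures.
From mathcomp Require Import all_boot all_order all_algebra.
From mathcomp Require Import fraction generic_quotient.
From mathcomp Require Import ring zify boolp.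

Set Implicit Arguments.
Unset Strict Implicit.
Unset Printing Implicit Defensive.

Import Order.TTheory GRing.Theory Num.Theory.
Local Open Scope ring_scope.

(** * Differential operators over a differential field *)

(** Up to conjugation by a function, the two factors of the right half that involve [y_i] form the
    second order operator with solutions [y_i] and [z], and those of the left half its formal
    adjoint. For [i = r] the three middle factors form its symmetric square, which is why [y_r]
    enters squared. The Bethe roots are never computed. What travels along the tuple is one
    statement: at the root of its left neighbour, an entry (squared for [i = r]) has the same
    logarithmic derivative as the power of [x] that finally replaces it. This yields the linear
    relations between old and new roots that make the Wronskians come out right. The delicate point
    is a Bethe root at 0, where these relations degenerate. The equations allow it formally when the
    label vanishes, and it has to be excluded by counting exponents further along the tuple.
    Admissibility speaks of arbitrary models of the modules, so the vector representation is rebuilt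
    inside any model, and weights are compared through partial sums of their coordinates. *)

Record derivation (F : fieldType) := Derivation {
  der_fun :> F -> F;
  derD : forall f g, der_fun (f + g) = der_fun f + der_fun g;
  derM : forall f g, der_fun (f * g) = der_fun f * g + f * der_fun g }.

Section Derivation.
Variables (F : fieldType) (d : derivation F).
Implicit Types (f g h : F) (P Q R : {poly F}).

Lemma der0 : d 0 = 0.
Proof. by apply: (addrI (d 0)); rewrite -derD !addr0. Qed.

Lemma der1 : d 1 = 0.
Proof. by apply: (addrI (d 1)); rewrite addr0 -[in RHS](mulr1 1) derM mulr1 mul1r. Qed.

Lemma derN f : d (- f) = - d f.
Proof. by apply/eqP; rewrite -addr_eq0 -derD addNr der0. Qed.

Lemma derB f g : d (f - g) = d f - d g.
Proof. by rewrite derD derN. Qed.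

Definition logder f := d f / f.

Lemma logderM f g : f != 0 -> g != 0 -> logder (f * g) = logder f + logder g.
Proof. by move=> f0 g0; rewrite /logder derM; field; rewrite f0 g0. Qed.

Lemma logder1 : logder 1 = 0.
Proof. by rewrite /logder der1 mul0r. Qed.

Lemma logderV f : f != 0 -> logder f^-1 = - logder f.
Proof.
move=> f0; apply/eqP; rewrite -addr_eq0 -logderM ?invr_eq0 //.
by rewrite mulVf // logder1.
Qed.

Lemma logder_div f g : f != 0 -> g != 0 -> logder (f / g) = logder f - logder g.
Proof. by move=> f0 g0; rewrite logderM ?invr_eq0 // logderV. Qed.

Lemma logder_sqr f : f != 0 -> logder (f ^+ 2) = logder f + logder f.
Proof. by move=> f0; rewrite expr2 logderM. Qed.

(** [sdmul] and [smul] repeat [dmul_d] and [dmul] for any derivation; over [ratfun_der] they agree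
    with them by conversion. *)
Definition sdmul Q := 'X * Q + map_poly d Q.

Definition smul P Q := \sum_(k < size P) P`_k *: iter k sdmul Q.

Definition sfactor f : {poly F} := 'X - f%:P.



Lemma sdmul0 : sdmul 0 = 0 :> {poly F}.
Proof. by rewrite /sdmul mulr0 map_poly0 addr0. Qed.

Lemma coef_map_der P k : (map_poly d P)`_k = d P`_k.
Proof. by rewrite coef_map_id0 // der0. Qed.

Lemma sdmulD P Q : sdmul (P + Q) = sdmul P + sdmul Q.
Proof.
rewrite /sdmul mulrDr addrACA; congr (_ + _); apply/polyP => k.
by rewrite coefD !coef_map_der coefD derD.
Qed.

Lemma sdmulZ f P : sdmul (f *: P) = f *: sdmul P + d f *: P.
Proof.
rewrite /sdmul scalerDr -addrA scalerAr; congr (_ + _); apply/polyP => k.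
by rewrite coefD coef_map_der !coefZ coef_map_der derM addrC.
Qed.

Lemma smul_widen n P Q : (size P <= n)%N ->
  smul P Q = \sum_(k < n) P`_k *: iter k sdmul Q.
Proof.
move=> sP; rewrite /smul (big_ord_widen n (fun k => P`_k *: iter k sdmul Q)) //.
rewrite big_mkcond; apply: eq_bigr => k _; case: ltnP => // sk.
by rewrite nth_default // scale0r.
Qed.

Lemma smulDl P Q R : smul (P + Q) R = smul P R + smul Q R.
Proof.
pose n := maxn (size P) (size Q).
rewrite (smul_widen _ (size_polyD P Q)).
rewrite (@smul_widen n P) ?leq_maxl // (@smul_widen n Q) ?leq_maxr //.
by rewrite -big_split; apply: eq_bigr => k _; rewrite coefD scalerDl.
Qed.

Lemma smulZl f P R : smul (f *: P) R = f *: smul P R.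
Proof.
rewrite (smul_widen _ (size_scale_leq f P)) scaler_sumr.
by apply: eq_bigr => k _; rewrite coefZ scalerA.
Qed.

Lemma smul0l R : smul 0 R = 0.
Proof. by rewrite /smul size_poly0 big_ord0. Qed.

Lemma smul1l R : smul 1 R = R.
Proof. by rewrite /smul size_poly1 big_ord1 coef1 scale1r. Qed.

Lemma smulCl f R : smul f%:P R = f *: R.
Proof. by rewrite -[f%:P]mulr1 mul_polyC smulZl smul1l. Qed.

Lemma smulXl P R : smul ('X * P) R =
  \sum_(k < size P) P`_k *: iter k.+1 sdmul R.
Proof.
rewrite (@smul_widen (size P).+1); last first.
  by rewrite mulrC (leq_trans (size_polyMleq _ _)) // size_polyX addn2.
rewrite big_ord_recl coefXM /= scale0r add0r.
by apply: eq_bigr => k _; rewrite coefXM.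
Qed.

(** Associativity for the left factor d; linearity in the left operand and induction on the powers
    of d then give [smulA]. *)
Lemma sdmul_smul P Q : sdmul (smul P Q) = smul (sdmul P) Q.
Proof.
have s : (size (map_poly d P) <= size P)%N by exact: size_poly.
rewrite {2}/sdmul smulDl smulXl (smul_widen _ s).
rewrite -big_split /smul (big_morph _ sdmulD sdmul0).
by apply: eq_bigr => k _; rewrite sdmulZ coef_map_der.
Qed.

Lemma smulA : associative smul.
Proof.
move=> P Q R; rewrite [smul P Q in RHS]/smul.
rewrite (big_morph (fun S => smul S R) (fun S S' => smulDl S S' R) (smul0l R)).
apply: eq_bigr => k _; rewrite smulZl; congr (_ *: _).
by elim: (val k) => //= n ->; rewrite sdmul_smul.
Qed.

Lemma smul1r P : smul P 1 = P.
Proof.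
rewrite /smul -[RHS]coefK poly_def; apply: eq_bigr => k _; congr (_ *: _).
elim: (val k) => [|n /= ->]; first by rewrite expr0.
rewrite /sdmul -exprS -[RHS]addr0; congr (_ + _); apply/polyP => j.
by rewrite coef_map_der coefXn coef0; case: (_ == _); rewrite ?der0 ?der1.
Qed.

(** The noncommutative monoid law lets ordered products be split around the few factors that
    reproduction changes. *)
HB.instance Definition _ :=
  Monoid.isLaw.Build ({poly F}) 1 smul smulA smul1l smul1r.

Lemma sfactorM f Q : smul (sfactor f) Q = sdmul Q - f *: Q.
Proof.
rewrite /sfactor -polyCN smulDl smulCl scaleNr; congr (_ - _).
by rewrite -['X]mulr1 smulXl size_poly1 big_ord1 coef1 scale1r.
Qed.

Lemma sdmulC f : sdmul f%:P = f *: 'X + (d f)%:P.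
Proof.
rewrite /sdmul mulrC mul_polyC; congr (_ + _); apply/polyP => k.
by rewrite coef_map_der !coefC; case: eqP => // _; rewrite der0.
Qed.

Lemma sdmulB P Q : sdmul (P - Q) = sdmul P - sdmul Q.
Proof.
by rewrite -scaleN1r sdmulD sdmulZ derN der1 oppr0 scale0r addr0 scaleN1r.
Qed.

Lemma sdmulXn n : sdmul 'X^n = 'X^(n.+1) :> {poly F}.
Proof.
rewrite /sdmul -exprS -[RHS]addr0; congr (_ + _); apply/polyP => j.
by rewrite coef_map_der coefXn coef0; case: (_ == _); rewrite ?der0 ?der1.
Qed.

Lemma sfactor2E f g : smul (sfactor f) (sfactor g) =
  'X^2 - (f + g) *: 'X + (f * g - d g)%:P.
Proof.
rewrite sfactorM /sfactor sdmulB sdmulC -['X]expr1 sdmulXn expr1.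
by rewrite -!mul_polyC polyCB polyCM polyCD; ring.
Qed.

Lemma sfactor3E f g h :
  smul (sfactor f) (smul (sfactor g) (sfactor h)) =
  'X^3 - (f + (g + h)) *: 'X^2
  + (f * (g + h) + (g * h - d h) - d (g + h)) *: 'X
  + (d (g * h - d h) - f * (g * h - d h))%:P.
Proof.
rewrite sfactor2E sfactorM sdmulD sdmulB sdmulC sdmulXn sdmulZ.
rewrite -['X]expr1 sdmulXn expr1.
move: (g + h) (g * h - d h) => a b.
by rewrite -!mul_polyC !(polyCB, polyCM, polyCD); ring.
Qed.

End Derivation.

(** * Rational functions as a differential field *)

Section RationalFunctions.
Variable K : fieldType.
Local Notation tofrac := (@FracField.tofrac {poly K}).
Implicit Types (p q : {poly K}) (f g : ratfun K).

Lemma frac_repr f : f = tofrac (\n_(repr f)) / tofrac (\d_(repr f)).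
Proof.
have d0 : tofrac (\d_(repr f)) != 0 by rewrite tofrac_eq0 denom_ratioP.
apply: (mulIf d0); rewrite divfK // -[X in X * _ = _]reprK.
move: (repr f) => x; unlock FracField.tofrac.
rewrite -[LHS]FracField.pi_mul; apply/eqmodP.
rewrite /= FracField.equivfE /FracField.mulf /=.
by rewrite !numden_Ratio ?oner_eq0 ?mulr1 ?denom_ratioP // mulrC.
Qed.

(** [fderiv] is computed on a chosen representative; differentiating the cross-multiplied equality
    [p * d = n * q] shows that every representative gives the same value. *)
Lemma fderiv_frac p q : q != 0 ->
  fderiv (tofrac p / tofrac q)
  = tofrac (p^`() * q - p * q^`()) / tofrac (q ^+ 2).
Proof.
move=> q0; set f := _ / _.
have := frac_repr f; rewrite /fderiv.
have := denom_ratioP (repr f).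
move: (\n_(repr f)) (\d_(repr f)) => n d d0; rewrite {}/f => e.
have e1 : p * d = n * q.
  apply/eqP; rewrite -(tofrac_eq (p * d)) !tofracM -eqr_div ?tofrac_eq0 //.
  by apply/eqP.
apply/eqP; rewrite eqr_div ?tofrac_eq0 ?expf_neq0 // -!tofracM tofrac_eq.
have := congr1 (@deriv K) e1; rewrite !derivM => e2.
apply/eqP.
have -> : (n^`() * d - n * d^`()) * q ^+ 2
  = (n^`() * q + n * q^`()) * (d * q) - (n * q) * (d^`() * q + d * q^`()) by ring.
by rewrite -e2 -e1; ring.
Qed.

Lemma ratfunW (P : ratfun K -> Prop) :
  (forall p q, q != 0 -> P (tofrac p / tofrac q)) -> forall f, P f.
Proof. by move=> h f; rewrite [f]frac_repr; apply/h/denom_ratioP. Qed.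

Lemma fderiv_tofrac p : fderiv (tofrac p) = tofrac p^`().
Proof.
rewrite -[tofrac p]divr1 -tofrac1 fderiv_frac ?oner_eq0 //.
by rewrite derivC mulr0 subr0 mulr1 expr1n tofrac1 divr1.
Qed.

Lemma fderivD f g : fderiv (f + g) = fderiv f + fderiv g.
Proof.
elim/ratfunW: f => p q q0; elim/ratfunW: g => p' q' q'0.
rewrite addf_div ?tofrac_eq0 // -!tofracM -tofracD.
rewrite !fderiv_frac ?mulf_neq0 // addf_div ?tofrac_eq0 ?expf_neq0 //.
rewrite -!tofracM -tofracD; congr (tofrac _ / tofrac _); rewrite ?exprMn //.
by rewrite !(derivD, derivM); ring.
Qed.

Lemma fderivM f g : fderiv (f * g) = fderiv f * g + f * fderiv g.
Proof.
elim/ratfunW: f => p q q0; elim/ratfunW: g => p' q' q'0.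
rewrite mulf_div -!tofracM !fderiv_frac ?mulf_neq0 //.
rewrite !mulf_div addf_div ?mulf_neq0 ?tofrac_eq0 ?expf_neq0 //.
apply/eqP; rewrite -!tofracM -tofracD eqr_div ?tofrac_eq0 ?mulf_neq0 ?expf_neq0 //.
rewrite -!tofracM tofrac_eq !derivM; apply/eqP; ring.
Qed.

Definition ratfun_der : derivation (ratfun K) := Derivation fderivD fderivM.

End RationalFunctions.

(** * Reproduction *)

Section Miura.
Variables (F : fieldType) (d : derivation F).
Implicit Types (c : F) (b : nat -> F).

(** The left half is determined by the right one through [c + c - b i], so a change of tuple has to
    be followed in [b] only. *)
Definition miura r c b : {poly F} :=
  smul d (\big[smul d/1]_(1 <= i < r.+1) sfactor (c + c - b i))
    (smul d (sfactor c)
      (\big[smul d/1]_(i <- rev (index_iota 1 r.+1)) sfactor (b i))).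

Lemma miura_inner k r c b b' : (1 <= k < r)%N ->
  (forall i, i != k -> i != k.+1 -> b i = b' i) ->
  b k.+1 + b k = b' k.+1 + b' k ->
  b k.+1 * b k - d (b k) = b' k.+1 * b' k - d (b' k) ->
  (c + c - b k) * (c + c - b k.+1) - d (c + c - b k.+1) =
  (c + c - b' k) * (c + c - b' k.+1) - d (c + c - b' k.+1) ->
  miura r c b = miura r c b'.
Proof.
move=> kr e e1 e2 e3; rewrite /miura.
have -> : index_iota 1 r.+1 = index_iota 1 k ++ [:: k; k.+1] ++ index_iota k.+2 r.+1.
  rewrite /index_iota; have -> : (r.+1 - 1 = (k - 1) + (2 + (r.+1 - k.+2)))%N by lia.
  by rewrite !iotaD subnKC ?addn2 //; case/andP: kr.
rewrite !rev_cat !big_cat /= !big_cons !big_nil !smul1r.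
congr (smul d _ (smul d _ _)).
  congr (smul d _ (smul d _ _)).
  - by apply: eq_big_nat => i ik; rewrite e //; lia.
  - rewrite !sfactor2E e3; congr (_ - _ *: _ + _).
    have s x y : c + c - x + (c + c - y) = (c + c) *+ 2 - (y + x) by ring.
    by rewrite !s e1.
  - by apply: eq_big_nat => i ik; rewrite e //; lia.
congr (smul d (smul d _ _) _).
- by apply: eq_big_seq => i; rewrite mem_rev mem_index_iota => ik; rewrite e //; lia.
- by rewrite !sfactor2E e1 e2.
- by apply: eq_big_seq => i; rewrite mem_rev mem_index_iota => ik; rewrite e //; lia.
Qed.

Lemma miura_last r c b b' : (1 <= r)%N ->
  (forall i, (i < r)%N -> b i = b' i) ->
  smul d (sfactor (c + c - b r)) (smul d (sfactor c) (sfactor (b r))) =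
  smul d (sfactor (c + c - b' r)) (smul d (sfactor c) (sfactor (b' r))) ->
  miura r c b = miura r c b'.
Proof.
move=> r0 e e3; rewrite /miura.
have -> : index_iota 1 r.+1 = rcons (index_iota 1 r) r.
  rewrite /index_iota -cats1; have -> : (r.+1 - 1 = (r - 1) + 1)%N by lia.
  by rewrite iotaD subnKC.
have h A X Y Z B : smul d (smul d A X) (smul d Y (smul d Z B)) =
    smul d (smul d A (smul d X (smul d Y Z))) B by rewrite !smulA.
rewrite rev_rcons !big_cons -!cats1 !big_cat !big_seq1 !h e3.
congr (smul d (smul d _ _) _).
  by apply: eq_big_nat => i ik; rewrite e //; lia.
by apply: eq_big_seq => i; rewrite mem_rev mem_index_iota => ik; rewrite e //; lia.
Qed.

Lemma derV (y : F) : y != 0 -> d (y^-1) = - d y / y ^+ 2.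
Proof.
move=> y0; have := derM d y y^-1; rewrite divff // der1 => e.
have -> : d y^-1 = (d y / y + y * d y^-1 - d y / y) / y by field.
by rewrite -e; field.
Qed.

(* Both sides are y''/y - (w'/w) (y'/y) for a solution y of the second order
   equation with Wronskian w. *)
Lemma riccati_wronskian (y z w : F) : y != 0 -> z != 0 -> w != 0 ->
  w = y * d z - d y * z ->
  d (logder d y) + logder d y ^+ 2 - logder d y * logder d w =
  d (logder d z) + logder d z ^+ 2 - logder d z * logder d w.
Proof.
move=> y0 z0 w0 e; have e' := congr1 d e; rewrite derB !derM in e'.
have h x : x != 0 -> d (logder d x) + logder d x ^+ 2 = d (d x) / x.
  by move=> x0; rewrite /logder derM derV //; field.
rewrite !h // /logder e'; move: w0; rewrite e => w0; field.
by rewrite y0 z0 w0.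
Qed.

Variables (r : nat) (T : nat -> F).
Hypothesis T0 : forall i, T i != 0.

Definition hatf (y : nat -> F) i : F :=
  if i == 0%N then 1 else if i == r then y r ^+ 2 else y i.

Definition Tp i : F := \prod_(1 <= j < i.+1) T j.

Definition mop (y : nat -> F) : {poly F} :=
  smul d
    (\big[smul d/1]_(1 <= i < r.+1)
       sfactor (logder d (hatf y i.-1 * Tp r ^+ 2 / (hatf y i * Tp i.-1))))
    (smul d (sfactor (logder d (Tp r)))
       (\big[smul d/1]_(i <- rev (index_iota 1 r.+1))
          sfactor (logder d (hatf y i * Tp i.-1 / hatf y i.-1)))).

Lemma eq_mop y y' : (forall i, (1 <= i <= r)%N -> y i = y' i) -> mop y = mop y'.
Proof.
move=> e.
have h i : (i <= r)%N -> hatf y i = hatf y' i.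
  rewrite /hatf; case: eqP => // /eqP i0 ir.
  by case: eqP => _; rewrite e //; lia.
rewrite /mop; congr (smul _ _ (smul _ _ _)).
  by apply: eq_big_nat => i ik; rewrite !h //; lia.
by apply: eq_big_seq => i; rewrite mem_rev mem_index_iota => ik; rewrite !h //; lia.
Qed.

Lemma Tp_neq0 i : Tp i != 0.
Proof. by rewrite prodf_seq_neq0; apply/allP => j _; rewrite T0. Qed.

Lemma hatf_neq0 y i : (forall i, y i != 0) -> hatf y i != 0.
Proof. by move=> y0; rewrite /hatf; do 2?case: ifP => _;
  rewrite ?oner_eq0 ?expf_neq0. Qed.

Definition mlog y i := logder d (hatf y i * Tp i.-1 / hatf y i.-1).

Lemma mlogE y i : (forall i, y i != 0) ->
  mlog y i = logder d (hatf y i) + logder d (Tp i.-1) - logder d (hatf y i.-1).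
Proof.
by move=> y0; rewrite /mlog logder_div ?logderM ?mulf_neq0 ?hatf_neq0 ?Tp_neq0.
Qed.

Lemma mopE y : (forall i, y i != 0) -> mop y = miura r (logder d (Tp r)) (mlog y).
Proof.
move=> y0; congr (smul _ _ _); apply: eq_bigr => i _; congr (sfactor _).
rewrite mlogE // logder_div ?logderM ?logder_sqr ?mulf_neq0 ?expf_neq0 ?hatf_neq0 ?Tp_neq0 //.
by ring.
Qed.

Lemma logderTp i : (0 < i)%N -> logder d (Tp i) = logder d (Tp i.-1) + logder d (T i).
Proof.
by case: i => // i _; rewrite /Tp big_nat_recr //= logderM // -/(Tp i) Tp_neq0.
Qed.

(** Put [g = Tp i.-1 / hatf y i.-1] and let w be the Wronskian. Up to constants, the factors of the
    right half belong to [g w / y i] and [g y i]: they form the conjugate by g of the second order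
    operator that kills [y i] and [z i]. *)
Lemma mop_reproduce_inner y z i kappa : (1 <= i < r)%N ->
  (forall j, y j != 0) -> (forall j, z j != 0) -> (forall j, j != i -> z j = y j) ->
  d kappa = 0 -> kappa != 0 ->
  y i * d (z i) - d (y i) * z i = kappa * T i * (hatf y i.-1 * hatf y i.+1) ->
  mop y = mop z.
Proof.
move=> ir y0 z0 e dk k0 ew; rewrite !mopE //.
have hy : hatf y i = y i by rewrite /hatf !ifF //; lia.
have hz : hatf z i = z i by rewrite /hatf !ifF //; lia.
have hh j : j != i -> hatf z j = hatf y j.
  move=> ji; rewrite /hatf; case: ifP => // _; case: eqP => jr; last by rewrite e.
  by rewrite e // -jr.
have /= := riccati_wronskian (y0 i) (z0 i) _ (esym ew).
rewrite !mulf_neq0 ?T0 ?hatf_neq0 // => /(_ isT).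
have -> : logder d (kappa * T i * (hatf y i.-1 * hatf y i.+1)) =
   logder d (T i) + (logder d (hatf y i.-1) + logder d (hatf y i.+1)).
  rewrite !logderM ?mulf_neq0 ?T0 ?hatf_neq0 //.
  by rewrite [logder d kappa]/logder dk mul0r add0r.
move=> E.
apply: (@miura_inner i) => //.
- move=> j ji ji1; rewrite !mlogE // !hh //.
  by apply: contra ji1; lia.
- by rewrite !mlogE //= hy hz !hh //; lazymatch goal with |- is_true _ => lia | _ => ring end.
- rewrite !mlogE //= hy hz !hh; [|lia|lia].
  move: E; rewrite (@logderTp i); last lia.
  move: (logder d (Tp i.-1)) (logder d (hatf y i.-1)) (logder d (hatf y i.+1)).
  move: (logder d (T i)) (logder d (y i)) (logder d (z i)) => t u v a p q E.
  rewrite !(derD, derN); apply/eqP; rewrite -subr_eq0; apply/eqP.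
  (* The difference of the two constant coefficients is the difference of the two sides of
     [riccati_wronskian]. *)
  set L := (X in X = _).
  have -> : L =
   (d v + v ^+ 2 - v * (t + (p + q))) - (d u + u ^+ 2 - u * (t + (p + q))) by rewrite /L; ring.
  by rewrite E subrr.
- rewrite !mlogE //= hy hz !hh; [|lia|lia].
  move: E; rewrite (@logderTp i); last lia.
  move: (logder d (Tp r)) (logder d (Tp i.-1)) (logder d (hatf y i.-1)) (logder d (hatf y i.+1)).
  move: (logder d (T i)) (logder d (y i)) (logder d (z i)) => t u v c a p q E.
  rewrite !(derD, derN); apply/eqP; rewrite -subr_eq0; apply/eqP.
  set L := (X in X = _).
  have -> : L =
   (d v + v ^+ 2 - v * (t + (p + q))) - (d u + u ^+ 2 - u * (t + (p + q))) by rewrite /L; ring.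
  by rewrite E subrr.
Qed.

(** The three middle factors form the conjugate by [Tp r.-1 / y r.-1] of the symmetric square of the
    second order operator that kills [y r] and [z r], so they depend on that operator only. *)
Lemma mop_reproduce_last y z kappa : (2 <= r)%N ->
  (forall j, y j != 0) -> (forall j, z j != 0) -> (forall j, j != r -> z j = y j) ->
  d kappa = 0 -> kappa != 0 ->
  y r * d (z r) - d (y r) * z r = kappa * T r * y r.-1 ->
  mop y = mop z.
Proof.
move=> r2 y0 z0 e dk k0 ew; rewrite !mopE //.
have hy : hatf y r = y r ^+ 2 by rewrite /hatf eqxx ifF //; lia.
have hz : hatf z r = z r ^+ 2 by rewrite /hatf eqxx ifF //; lia.
have hyp : hatf y r.-1 = y r.-1 by rewrite /hatf !ifF //; lia.
have hh j : j != r -> hatf z j = hatf y j.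
  by move=> jr; rewrite /hatf (negPf jr) e.
have /= := riccati_wronskian (y0 r) (z0 r) _ (esym ew).
rewrite !mulf_neq0 ?T0 // => /(_ isT).
have -> : logder d (kappa * T r * y r.-1) = logder d (T r) + logder d (y r.-1).
  rewrite !logderM ?mulf_neq0 ?T0 //.
  by rewrite [logder d kappa]/logder dk mul0r add0r.
move=> E; apply: miura_last; first lia.
  by move=> j jr; rewrite !mlogE // !hh //; lia.
rewrite !sfactor3E !mlogE // hy hz !hh; last lia.
rewrite !logder_sqr // hyp (@logderTp r); last lia.
move: E (congr1 d E).
move: (logder d (T r)) (logder d (y r.-1)) (logder d (Tp r.-1)) (logder d (y r)) (logder d (z r)).
move=> t p a u v E.
rewrite !(derD, derN, derM, exprS, expr0, mulr1) => E'.
have hu x : d x * x + x * d x = x * d x *+ 2 by rewrite [d x * x]mulrC mulr2n.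
congr (_ - _ *: _ + _ *: _ + _%:P).
- by ring.
- apply/eqP; rewrite -subr_eq0; apply/eqP; set L := (X in X = _).
  have -> : L = (d v + v ^+ 2 - v * (t + p) - (d u + u ^+ 2 - u * (t + p))) *+ 4
     by rewrite /L; ring.
  by rewrite E subrr mul0rn.
- apply/eqP; rewrite -subr_eq0; apply/eqP; set L := (X in X = _).
  (* [B x] is the derivative of [A x]: the constant coefficient of a symmetric square involves the
     Riccati identity [E] together with its derivative [E']. *)
  pose A x := d x + x ^+ 2 - x * (t + p).
  pose B x := d (d x) + (d x * x + x * d x) - (d x * (t + p) + x * (d t + d p)).
  have -> : L = (B v - B u) *+ 2 + (a + t) *+ 4 * (A u - A v) by rewrite /L /A /B; ring.
  by rewrite /A /B E -E' !subrr mulr0 mul0rn addr0.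
Qed.

End Miura.

Lemma dmulE (K : fieldType) : @dmul K = smul (ratfun_der K).
Proof. by rewrite /dmul -[@dmul_d K]/(sdmul (ratfun_der K)). Qed.

Lemma DopE (K : fieldType) r (lam : weight r) y :
  Dop lam y = mop (ratfun_der K) r (Tfun K lam) y.
Proof.
rewrite /Dop /mop dmulE -[@dfactor K]/(@sfactor (ratfun K)).
by rewrite -[@lnd K]/(logder (ratfun_der K)).
Qed.

(** * Reproduction for tuples of polynomials *)

Section PolyTuples.
Variables (K : fieldType) (r : nat) (lam : weight r).
Local Notation tofrac := (@FracField.tofrac {poly K}).
Implicit Types (Y : nat -> {poly K}) (z : {poly K}).

(* [Y 0 = 'X - 1] takes the factor [x - 1] out of [T_1], which makes the
   reproduction equation uniform in [1 <= i <= r]. *)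
Definition hat Y j := if j == r then Y r ^+ 2 else Y j.

(** The exponents in [nbr] are negated Cartan integers: the coroot of direction [r.-1] pairs to -2
    with the last root, while the last coroot pairs to -1 with the root before it. Hence only the
    right neighbour can be squared. *)
Definition rnb Y j := if j == r then 1 else hat Y j.+1.

Definition nbr Y j := Y j.-1 * rnb Y j.

Definition upd Y i z j := if j == i then z else Y j.

Definition DY Y := Dop lam (fun i => tofrac (Y i)).

Lemma Tfun_neq0 i : Tfun K lam i != 0.
Proof.
rewrite /Tfun mulf_neq0 ?expf_neq0 ?tofrac_eq0 ?polyX_eq0 //.
by case: ifP; rewrite ?oner_eq0 // -tofrac1 -tofracB tofrac_eq0 polyXsubC_eq0.
Qed.

Lemma eq_DY Y Y' : (forall i, (1 <= i <= r)%N -> Y i = Y' i) -> DY Y = DY Y'.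
Proof. by move=> e; rewrite /DY !DopE; apply: eq_mop => i /e ->. Qed.

Lemma DY_reproduce Y i z kappa : (2 <= r)%N -> (1 <= i <= r)%N ->
  (forall j, Y j != 0) -> z != 0 -> Y 0 = 'X - 1%:P -> kappa != 0 ->
  Y i * z^`() - (Y i)^`() * z = kappa *: ('X^(label lam i) * nbr Y i) ->
  DY Y = DY (upd Y i z).
Proof.
move=> r2 ir Y0 z0 Y00 k0 e; rewrite /DY !DopE.
have Yn j : tofrac (Y j) != 0 by rewrite tofrac_eq0.
have Zn j : tofrac (upd Y i z j) != 0 by rewrite tofrac_eq0 /upd; case: ifP.
have ne j : j != i -> tofrac (upd Y i z j) = tofrac (Y j).
  by rewrite /upd => /negPf ->.
have dk : ratfun_der K (tofrac kappa%:P) = 0.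
  by rewrite /= fderiv_tofrac derivC tofrac0.
have kn : tofrac kappa%:P != 0 by rewrite tofrac_eq0 polyC_eq0.
have W : tofrac (Y i) * ratfun_der K (tofrac (upd Y i z i))
   - ratfun_der K (tofrac (Y i)) * tofrac (upd Y i z i)
   = tofrac (kappa%:P * ('X^(label lam i) * nbr Y i)).
  by rewrite /= !fderiv_tofrac -!tofracM -tofracB /upd eqxx e mul_polyC.
have [ir' | /negP irn] := boolP (i == r).
  have {ir'} ? := eqP ir'; subst i.
  apply: (mop_reproduce_last (@Tfun_neq0) r2 Yn Zn ne dk kn).
  rewrite W /nbr /rnb eqxx mulr1 /Tfun /ratX ifF; last lia.
  by rewrite !tofracM tofracXn mulr1 mulrA.
apply: (mop_reproduce_inner (@Tfun_neq0) _ Yn Zn ne dk kn); first lia.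
rewrite W /nbr /rnb ifF; last by apply/negP.
have -> : hatf r (fun j => tofrac (Y j)) i.+1 = tofrac (hat Y i.+1).
  by rewrite /hatf /hat /=; case: ifP => _; rewrite ?tofracXn.
rewrite /Tfun /hatf; case: (eqVneq i 1%N) => [-> /=|i1].
  by rewrite Y00 !tofracM tofracXn mul1r tofracB tofrac1 -!mulrA.
rewrite ifF; last lia; rewrite ifF; last lia.
by rewrite !tofracM tofracXn mulr1 -!mulrA.
Qed.

End PolyTuples.

(** * Local analysis of the Bethe equations *)

Definition evalE := (hornerD, hornerN, hornerM, hornerX, hornerC, hornerZ,
  hornerMn, hornerXn, hornerXsubC, horner_exp).

Section Bethe.
Variable K : numFieldType.
Implicit Types (y g A : {poly K}) (p q s : K) (N e : nat).

(* The logarithmic derivatives at [p] of [y'] and of [x^N A] coincide; when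
   [p = 0], which is allowed for [N = 0] only, [N / p] is [0]. *)
Definition bethe_at N y A := forall p, root y p ->
  [/\ A.[p] != 0, (N == 0%N) || (p != 0)
    & y^`()^`().[p] * A.[p] = y^`().[p] * (N%:R / p * A.[p] + A^`().[p])].

(** The logarithmic derivative of [x^e] at [p] is [e / p], so pure powers of [x] among the
    neighbours can be counted in the label. *)
Lemma bethe_at_shift N e y A : bethe_at N y ('X^e * A) -> bethe_at (N + e) y A.
Proof.
case: e => [|e]; first by rewrite expr0 mul1r addn0.
move=> h p /h []; rewrite hornerM hornerXn derivM derivXn.
rewrite mulf_eq0 expf_eq0 /= negb_or => /andP [p0 A0] _ E.
split=> //; first by rewrite p0 orbT.
have pe : p ^+ e.+1 != 0 by rewrite expf_neq0.
apply: (mulfI pe); rewrite mulrCA E !evalE natrD.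
by rewrite /= -mulr_natr !exprS; field.
Qed.

Lemma double_root (H : {poly K}) p : H.[p] = 0 -> H^`().[p] = 0 ->
  exists G, H = G * ('X - p%:P) ^+ 2.
Proof.
move=> /eqP /factor_theorem [G ->]; rewrite derivM derivXsubC !evalE subrr.
rewrite mulr0 add0r mulr1 => /eqP /factor_theorem [G' ->].
by exists G'; rewrite expr2 mulrA.
Qed.

Lemma two_double_roots (H : {poly K}) p q : p != q -> (size H <= 4)%N ->
  H.[p] = 0 -> H^`().[p] = 0 -> H.[q] = 0 -> H^`().[q] = 0 -> H = 0.
Proof.
move=> pq sH Hp Hp' Hq Hq'; have [G eG] := double_root Hp Hp'.
have pq0 : (q - p) ^+ 2 != 0 by rewrite expf_neq0 // subr_eq0 eq_sym.
have Gq : G.[q] = 0.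
  by move: Hq; rewrite eG !evalE => /eqP; rewrite mulf_eq0 (negPf pq0) orbF => /eqP.
have Gq' : G^`().[q] = 0.
  move: Hq'; rewrite eG derivM !evalE Gq mul0r addr0 => /eqP.
  by rewrite mulf_eq0 (negPf pq0) orbF => /eqP.
have [G2 eG2] := double_root Gq Gq'.
apply/eqP; apply: contraLR sH => H0; rewrite -ltnNge eG eG2.
have G20 : G2 != 0 by apply: contraNneq H0 => e0; rewrite eG eG2 e0 !mul0r.
rewrite -mulrA size_Mmonic //; last by rewrite monicMl ?monic_exp ?monicXsubC.
rewrite size_Mmonic ?monic_exp ?monicXsubC ?expf_neq0 ?polyXsubC_eq0 //.
rewrite !size_exp_XsubC; move: G20; rewrite -size_poly_gt0;
  by case: (size G2) => // n _; rewrite addnC.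
Qed.

Lemma deriv_quadratic p q :
  (('X - p%:P) * ('X - q%:P))^`() = 'X *+ 2 - (p + q)%:P.
Proof. by rewrite derivM !derivXsubC polyCD mulr2n; ring. Qed.

Lemma deriv2_quadratic p q : (('X - p%:P) * ('X - q%:P))^`()^`() = 2%:P.
Proof. by rewrite deriv_quadratic derivB derivMn derivX derivC subr0 polyC_natr. Qed.

Lemma bethe_quadratic N p q g : bethe_at N (('X - p%:P) * ('X - q%:P)) g ->
  [/\ g.[p] != 0, (N == 0%N) || (p != 0)
    & 2 * g.[p] = (p - q) * (N%:R / p * g.[p] + g^`().[p])].
Proof.
move=> /(_ p); rewrite rootM root_XsubC eqxx /= => /(_ isT) [-> ->].
rewrite deriv2_quadratic deriv_quadratic !evalE => E; split=> //.
by rewrite E; congr (_ * _); ring.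
Qed.

Lemma bethe_linear N p g : bethe_at N ('X - p%:P) g ->
  [/\ g.[p] != 0, (N == 0%N) || (p != 0) & N%:R / p * g.[p] + g^`().[p] = 0].
Proof.
move=> /(_ p); rewrite root_XsubC eqxx => /(_ isT) [-> ->].
by rewrite derivXsubC derivC horner0 !evalE mul0r mul1r => E; split.
Qed.

(* [L] is determined by its values at [p] and [q], which make the two sides
   agree there; the last two hypotheses say that the derivatives agree as well,
   and two double roots are too many for a polynomial of degree 3. *)
Lemma quad_reproduce N p q g : p != q -> p != 0 -> q != 0 -> (size g <= 4)%N ->
  2 * g.[p] = (p - q) * (N%:R / p * g.[p] + g^`().[p]) ->
  2 * g.[q] = (q - p) * (N%:R / q * g.[q] + g^`().[q]) ->
  let y := ('X - p%:P) * ('X - q%:P) in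
  exists a b, let L := a *: 'X + b%:P in
   y * (N.+1%:R *: L + 'X * L^`()) - 'X * y^`() * L = g.
Proof.
move=> pq p0 q0 sg hp hq y.
(* The equation aimed at is the Wronskian identity of [y] and [x^(N+1) L], divided by [x^N]. *)
have pq0 : p - q != 0 by rewrite subr_eq0.
have qp0 : q - p != 0 by rewrite subr_eq0 eq_sym.
pose Lp := - g.[p] / (p * (p - q)); pose Lq := - g.[q] / (q * (q - p)).
pose a := (Lp - Lq) / (p - q); pose b := Lp - a * p.
exists a, b => L; apply/eqP; rewrite -subr_eq0; apply/eqP.
have Ep : L.[p] = Lp by rewrite /L !evalE /b; ring.
have Eq : L.[q] = Lq by rewrite /L !evalE /b /a; field.
have L' : L^`() = a%:P by rewrite derivD derivZ derivX derivC addr0 alg_polyC.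
have y'E : y^`() = 'X *+ 2 - (p + q)%:P by apply: deriv_quadratic.
have y''E : y^`()^`() = 2%:P by apply: deriv2_quadratic.
have yp : y.[p] = 0 by rewrite /y !evalE subrr mul0r.
have yq : y.[q] = 0 by rewrite /y !evalE subrr mulr0.
have y'p : y^`().[p] = p - q by rewrite y'E !evalE; ring.
have y'q : y^`().[q] = q - p by rewrite y'E !evalE; ring.
have eY : y = ('X - p%:P) * ('X - q%:P) by [].
have eL : L = a *: 'X + b%:P by [].
clearbody y L; set H := _ - g.
have H'E : H^`() = y^`() * (N.+1%:R *: L + 'X * a%:P)
     + y * (N.+1%:R *: a%:P + a%:P) - (y^`() * L + 'X * 2%:P * L + 'X * y^`() * a%:P) - g^`().
  rewrite /H !(derivB, derivM, derivD, derivZ) y''E L' !derivX !derivC.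
  by rewrite mulr0 addr0 !mul1r mulrDl.
apply: (two_double_roots pq).
- rewrite /H L' {1}eL {1}eL {1}eY.
  have -> : ('X - p%:P) * ('X - q%:P) *
     (N.+1%:R *: (a *: 'X + b%:P) + 'X * a%:P) - 'X * y^`() * (a *: 'X + b%:P) - g
   = (N%:R * a) *: 'X^3 + (N%:R * b + b - (p + q) * (N%:R * a + a + a) + (p + q) * a - b *+ 2) *: 'X^2
     + ((p * q) * (N%:R * a + a + a) - (p + q) * (N%:R * b)) *: 'X
     + ((p * q) * (N%:R * b + b))%:P - g.
    rewrite y'E -(natr1 N) -!mul_polyC !(polyCD, polyCN, polyCM, polyCMn).
    by ring.
  apply: leq_trans (size_polyD _ _) _; rewrite geq_max size_polyN sg andbT.
  apply: leq_trans (size_polyD _ _) _; rewrite geq_max (leq_trans (size_polyC_leq1 _)) // andbT.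
  apply: leq_trans (size_polyD _ _) _; rewrite geq_max.
  rewrite (leq_trans (size_scale_leq _ _)) ?size_polyX // andbT.
  apply: leq_trans (size_polyD _ _) _; rewrite geq_max.
  by rewrite !(leq_trans (size_scale_leq _ _)) ?size_polyXn.
- rewrite /H hornerD hornerN hornerD hornerN !hornerM yp y'p Ep hornerX /Lp.
  by field; rewrite p0 pq0.
- rewrite H'E !(hornerD, hornerN, hornerM, hornerZ) yp y'p Ep !hornerC hornerX.
  have -> : g^`().[p] = 2 * g.[p] / (p - q) - N%:R / p * g.[p] by rewrite hp; field;
    rewrite pq0 p0.
  by rewrite /Lp -natr1; field; rewrite p0 pq0.
- rewrite /H hornerD hornerN hornerD hornerN !hornerM yq y'q Eq hornerX /Lq.
  by field; rewrite q0 qp0.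
- rewrite H'E !(hornerD, hornerN, hornerM, hornerZ) yq y'q Eq !hornerC hornerX.
  have -> : g^`().[q] = 2 * g.[q] / (q - p) - N%:R / q * g.[q] by rewrite hq; field;
    rewrite qp0 q0.
  by rewrite /Lq -natr1; field; rewrite q0 qp0.
Qed.

End Bethe.

Section Steps.
Variable K : numFieldType.
Implicit Types (y g A : {poly K}) (p q s : K) (N e : nat).

(** Comparison with the right-hand side of [quad_reproduce] fixes the slope of [L]: for nonzero [N]
    it is [1 / N] if that side is a monic cubic and 0 if it is quadratic. *)
Lemma coef3_wronskian N p q a b :
  (('X - p%:P) * ('X - q%:P) * (N.+1%:R *: (a *: 'X + b%:P) + 'X * a%:P)
    - 'X * (('X - p%:P) * ('X - q%:P))^`() * (a *: 'X + b%:P))`_3 = N%:R * a.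
Proof.
set P : {poly K} := _ - _.
have -> : P = (N%:R * a) *: 'X^3
     + (N%:R * b + b - (p + q) * (N%:R * a + a + a) + (p + q) * a - b *+ 2) *: 'X^2
     + ((p * q) * (N%:R * a + a + a) - (p + q) * (N%:R * b)) *: 'X
     + ((p * q) * (N%:R * b + b))%:P.
  rewrite /P deriv_quadratic -(natr1 N) -!mul_polyC !(polyCD, polyCN, polyCM, polyCMn).
  by ring.
by rewrite !coefD !coefZ !coefXn coefX coefC /= !mulr0 !addr0 mulr1.
Qed.

Lemma coef3_cubic p q s : (('X - p%:P) * (('X - q%:P) * ('X - s%:P)))`_3 = 1.
Proof.
have -> : ('X - p%:P) * (('X - q%:P) * ('X - s%:P)) =
   1 *: 'X^3 + (- (p + q + s)) *: 'X^2 + (p * q + p * s + q * s) *: 'X + (- (p * q * s))%:P.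
  by rewrite -!mul_polyC !(polyCD, polyCN, polyCM); ring.
by rewrite !coefD !coefZ !coefXn coefX coefC /= !mulr0 !addr0 mulr1.
Qed.

Lemma size_cubic p q s : (size (('X - p%:P) * (('X - q%:P) * ('X - s%:P)))%R <= 4)%N.
Proof.
rewrite !size_Mmonic ?monicXsubC ?polyXsubC_eq0 // ?monicMl ?monicXsubC //.
by rewrite !size_XsubC.
Qed.

Lemma deriv_cubic p q s : (('X - p%:P) * (('X - q%:P) * ('X - s%:P)))^`() =
  ('X - q%:P) * ('X - s%:P) + ('X - p%:P) * ('X *+ 2 - (q + s)%:P).
Proof. by rewrite derivM deriv_quadratic derivXsubC mul1r. Qed.

(* For [N = 0] the hypothesis would make the third divided difference of the
   monic cubic polynomial at [p, p, p', p'] vanish, but it is 1. *)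
Lemma bethe_cubic_pos N p p' q s1 s2 : p != p' ->
  bethe_at N (('X - p%:P) * ('X - p'%:P)) (('X - q%:P) * (('X - s1%:P) * ('X - s2%:P))) ->
  N != 0%N.
Proof.
move=> pp' h; apply/eqP => N0; move: h; rewrite {}N0 => h.
have [_ _ E] := bethe_quadratic h.
rewrite mulrC in h; have [_ _ E'] := bethe_quadratic h.
move: E E'; rewrite !mul0r !add0r deriv_cubic !evalE => E E'.
have : (p - p') ^+ 3 = 0; last first.
  by move/eqP; rewrite expf_eq0 subr_eq0 (negPf pp').
have -> : (p - p') ^+ 3 =
  2 * ((p' - q) * ((p' - s1) * (p' - s2)))
  - (p' - p) * ((p' - s1) * (p' - s2) + (p' - q) * (p' *+ 2 - (s1 + s2)))
  - (2 * ((p - q) * ((p - s1) * (p - s2)))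
     - (p - p') * ((p - s1) * (p - s2) + (p - q) * (p *+ 2 - (s1 + s2)))) by ring.
by rewrite E E' !subrr.
Qed.

(** Multiplying the [L] of [quad_reproduce] by [N] makes it monic; this produces the new root [s]
    and the constant [N] on the right. *)
Lemma quad_step N p p' q s1 s2 : p != p' ->
  bethe_at N (('X - p%:P) * ('X - p'%:P)) (('X - q%:P) * (('X - s1%:P) * ('X - s2%:P))) ->
  let y := ('X - p%:P) * ('X - p'%:P) in
  [/\ N != 0%N, p != 0, p' != 0 & exists s,
    y * (N.+1%:R *: ('X - s%:P) + 'X) - 'X * y^`() * ('X - s%:P)
    = N%:R *: (('X - q%:P) * (('X - s1%:P) * ('X - s2%:P)))].
Proof.
move=> pp' h y; have N0 := bethe_cubic_pos pp' h.
have [_ p0 E] := bethe_quadratic h.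
rewrite mulrC in h; have [_ p'0 E'] := bethe_quadratic h.
rewrite (negPf N0) /= in p0 p'0; split=> //.
have /= [a [b]] := quad_reproduce pp' p0 p'0 (size_cubic _ _ _) E E'.
have -> : (a *: 'X + b%:P)^`() = a%:P.
  by rewrite derivD derivZ derivX derivC addr0 alg_polyC.
move=> eL; have := congr1 (fun P : {poly K} => P`_3) eL.
rewrite coef3_wronskian coef3_cubic => Na.
have Nn : N%:R != 0 :> K by rewrite pnatr_eq0.
exists (- (N%:R * b)); rewrite -[in RHS]eL -/y.
have e1 : 'X - (- (N%:R * b))%:P = N%:R *: (a *: 'X + b%:P).
  by rewrite scalerDr scalerA Na scale1r -mul_polyC -polyCM polyCN opprK.
have e2 : 'X = N%:R *: ('X * a%:P) :> {poly K}.
  by rewrite [in RHS]mulrC mul_polyC scalerA Na scale1r.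
by rewrite e1 [X in y * (_ + X)]e2 -!mul_polyC; ring.
Qed.

Lemma coef3_quadratic p q : (('X - p%:P) * ('X - q%:P))`_3 = 0.
Proof. by rewrite nth_default // size_Mmonic ?monicXsubC ?polyXsubC_eq0 // !size_XsubC. Qed.

(** The case of a left neighbour that is a pure power: without a cubic term on the right, [L] is a
    nonzero constant and reproduction gives [x^(N+1)] itself. *)
Lemma quad_step_pure N p p' s1 s2 : N != 0%N -> p != p' ->
  bethe_at N (('X - p%:P) * ('X - p'%:P)) (('X - s1%:P) * ('X - s2%:P)) ->
  let y := ('X - p%:P) * ('X - p'%:P) in
  [/\ p != 0, p' != 0 & exists2 k, k != 0 &
    N.+1%:R *: y - 'X * y^`() = k *: (('X - s1%:P) * ('X - s2%:P))].
Proof.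
move=> N0 pp' h y; have [g0 p0 E] := bethe_quadratic h.
rewrite mulrC in h; have [_ p'0 E'] := bethe_quadratic h.
rewrite (negPf N0) /= in p0 p'0; split=> //.
have sg : (size (('X - s1%:P) * ('X - s2%:P))%R <= 4)%N.
  by rewrite size_Mmonic ?monicXsubC ?polyXsubC_eq0 // !size_XsubC.
have /= [a [b]] := quad_reproduce pp' p0 p'0 sg E E'.
have -> : (a *: 'X + b%:P)^`() = a%:P.
  by rewrite derivD derivZ derivX derivC addr0 alg_polyC.
move=> eL; have := congr1 (fun P : {poly K} => P`_3) eL.
rewrite coef3_wronskian coef3_quadratic => /eqP.
rewrite mulf_eq0 pnatr_eq0 (negPf N0) /= => /eqP a0.
move: eL; rewrite a0 scale0r add0r mulr0 addr0 -/y => eL.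
have b0 : b != 0.
  apply: contraNneq g0 => b0; rewrite -eL b0 polyC0 scaler0 !mulr0 subr0.
  by rewrite horner0.
exists b^-1; first by rewrite invr_eq0.
rewrite -eL -mul_polyC -[in RHS]mul_polyC -(mul_polyC _ b%:P).
transitivity ((b^-1 * b)%:P * (N.+1%:R%:P * y - 'X * y^`()));
  first by rewrite mulVf // mul1r.
by rewrite polyCM; ring.
Qed.

End Steps.

(** * Descent to powers of x *)

(** The Wronskian of [x^n (x - s)] and [x^(k+n+1)], with [P] standing for [x^(n-1)] and [P'] for
    [x^(k+n)]; the hypothesis puts the remaining root at [q]. *)
Lemma down_wronskian (A : comNzRingType) (X q s k n P P' : A) :
  k * q = (k + 1) * s ->
  X * P * (X - s) * ((k + (n + 1)) * P') - P * (n * (X - s) + X) * (X * P') =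
  k * (P * (X - q) * (X * P')).
Proof.
move=> e; apply/eqP; rewrite -subr_eq0; apply/eqP.
by transitivity (X * P * P' * (k * q - (k + 1) * s)); [ring | rewrite e subrr mulr0].
Qed.

Section Chain.
Variables (K : numFieldType) (r : nat) (lam : weight r).
Local Notation lb := (label lam).
Local Notation hat := (@hat K r).
Local Notation rnb := (@rnb K r).
Local Notation nbr := (@nbr K r).
Implicit Types (Y : nat -> {poly K}) (q s : K) (N e a i j : nat).

(** The condition says that [y] and [x^N B] have equal logarithmic derivatives at the roots of [Z].
    It holds when [x^N B] is reproduced from [y], since their Wronskian then vanishes at these
    roots. *)
Lemma bethe_transfer M N (y B Z R : {poly K}) :
  bethe_at M Z (y * R) ->
  (forall p, root Z p -> [/\ p != 0, B.[p] != 0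
    & y.[p] * (N%:R * B.[p] + p * B^`().[p]) = p * y^`().[p] * B.[p]]) ->
  bethe_at (M + N) Z (B * R).
Proof.
move=> h hB p Zp; have [p0 B0 E] := hB p Zp; have [] := h p Zp.
rewrite !(evalE, derivM) mulf_eq0 negb_or => /andP [y0 R0] _ E'.
split; rewrite ?p0 ?orbT // ?mulf_neq0 //.
apply: (mulfI (mulf_neq0 y0 p0)); rewrite natrD.
have -> : y.[p] * p * (Z^`()^`().[p] * (B.[p] * R.[p])) =
  p * B.[p] * (Z^`()^`().[p] * (y.[p] * R.[p])) by ring.
rewrite E'.
have -> : p * B.[p] * (Z^`().[p] * (M%:R / p * (y.[p] * R.[p]) +
   (y^`().[p] * R.[p] + y.[p] * R^`().[p]))) =
  Z^`().[p] * (M%:R * y.[p] * B.[p] * R.[p] + R.[p] * (p * y^`().[p] * B.[p])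
    + p * y.[p] * B.[p] * R^`().[p]) by field.
by rewrite -E; field.
Qed.

Definition good Y := (forall j, Y j != 0) /\ Y 0 = 'X - 1%:P.

(** The shape for [l_j = 2] when [i <= j < r] and [l_r = 1]. The two roots are distinct because
    [quad_reproduce] interpolates at them. *)
Definition quads Y i :=
  (forall j, (i <= j < r)%N ->
     exists p p', p != p' /\ Y j = ('X - p%:P) * ('X - p'%:P)) /\
  exists u, Y r = 'X - u%:P.

(** As [Y r] enters squared, halving its exponent makes [hat] equal to the same power [x^(2a)] in
    all directions from [i] on. *)
Definition tail Y i a j : {poly K} :=
  if (i <= j)%N then 'X^(if j == r then a else a.*2) else Y j.

Lemma hat_quads Y i j : quads Y i -> (i <= j < r)%N ->
  exists s1 s2, hat Y j.+1 = ('X - s1%:P) * ('X - s2%:P).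
Proof.
move=> [h [u hu]] ij; rewrite /hat; case: eqP => [_|jr].
  by exists u, u; rewrite hu.
by have [|p [p' [_ ->]]] := h j.+1; [lia | exists p, p'].
Qed.

Lemma root_hat Y j p : root (hat Y j) p = root (Y j) p.
Proof. by rewrite /hat; case: eqP => // ->; rewrite rootE horner_exp expf_eq0 rootE. Qed.

Lemma hat_upd Y i z j : (i < r)%N -> j != i -> hat (upd Y i z) j = hat Y j.
Proof.
move=> ir /negPf ji; rewrite /hat /upd ji; case: eqP => // _.
by rewrite ifF //; lia.
Qed.

Lemma rnb_upd Y i z j : (i < r)%N -> j.+1 != i -> rnb (upd Y i z) j = rnb Y j.
Proof. by move=> ir ji; rewrite /rnb; case: eqP => // _; rewrite hat_upd. Qed.

Lemma nbr_upd Y i z j : (i < r)%N -> j.-1 != i -> j.+1 != i -> nbr (upd Y i z) j = nbr Y j.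
Proof. by move=> ir ji ji1; rewrite /nbr rnb_upd // /upd (negPf ji). Qed.

Lemma good_upd Y i z : (0 < i)%N -> z != 0 -> good Y -> good (upd Y i z).
Proof.
move=> i0 z0 [Y0 Y00]; split=> [j|]; first by rewrite /upd; case: ifP.
by rewrite /upd ifF //; lia.
Qed.

Lemma quads_upd Y i z : (i < r)%N -> quads Y i -> quads (upd Y i z) i.+1.
Proof.
move=> ir [h [u hu]]; split=> [j ij|]; last by exists u; rewrite /upd ifF //; lia.
by have [|p [p' e]] := h j; [lia | exists p, p'; rewrite /upd ifF //; lia].
Qed.

Lemma quads_le Y i j : (i <= j)%N -> quads Y i -> quads Y j.
Proof. by move=> ij [h hu]; split=> // k jk; apply: h; lia. Qed.

(* For [e = 1], this shows that the Bethe root in direction [i.-1] is not 0. *)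
Lemma bethe_tail_contra n i : (r - i <= n)%N -> (1 <= i <= r)%N ->
  forall Y e, (0 < e)%N -> quads Y i ->
  bethe_at (lb i + e) (Y i) (rnb Y i) ->
  (forall j, (i < j <= r)%N -> bethe_at (lb j) (Y j) (nbr Y j)) -> False.
Proof.
elim: n i => [|n IH] i.
  move=> ni ir Y e e0 [_ [u hu]]; have -> : i = r by lia.
  (* With a pure power on the left, the last equation reads [(lb r + e) / u = 0] with [u] nonzero
     and a positive numerator. *)
  rewrite hu /rnb eqxx => /bethe_linear [_ u0 E] _.
  move: E; rewrite derivC horner0 hornerC addr0 mulr1 => /eqP.
  rewrite mulf_eq0 invr_eq0 pnatr_eq0; apply/negP; rewrite negb_or.
  have N0 : (lb r + e != 0)%N by rewrite -lt0n addn_gt0 e0 orbT.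
  by rewrite (negPf N0) /= in u0 *.
move=> ni ir Y e e0 Q B H.
have [ir'|ir'] := ltnP i r; last by apply: (IH i _ _ Y e) => //; lia.
have ii : (i <= i < r)%N by lia.
have [s1 [s2 eh]] := hat_quads Q ii.
have [|p [p' [pp' eY]]] := Q.1 i; first lia.
move: B; rewrite /rnb ifF; last lia.
rewrite eh eY => B.
have N0 : (lb i + e)%N != 0%N by rewrite -lt0n addn_gt0 e0 orbT.
have [p0 p'0 [k k0 E]] := quad_step_pure N0 pp' B.
rewrite -eY -eh in E.
(* The reproduced entry is [x^(lb i + e + 1)]; its exponent is carried by the new [e], which leaves
   the entry 1. *)
pose Y1 := upd Y i 1.
apply: (IH i.+1 _ _ Y1 (lb i + e).+1); [lia|lia|by []|exact: quads_upd| |].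
- rewrite rnb_upd //; last lia.
  have -> : Y1 i.+1 = Y i.+1 by rewrite /Y1 /upd ifF //; lia.
  rewrite -[rnb Y i.+1]mul1r; apply: bethe_transfer.
    by apply: H; lia.
  move=> t rt; have yt : (Y i).[t] != 0.
    have /H /(_ t rt) [A0 _ _] : (i < i.+1 <= r)%N by lia.
    by move: A0; rewrite /nbr hornerM mulf_eq0 negb_or => /andP [].
  have := congr1 (fun P => P.[t]) E; rewrite !evalE.
  have /rootP -> : root (hat Y i.+1) t by rewrite root_hat.
  rewrite mulr0 => E0; rewrite derivC horner0 oner_neq0 !mulr1 mulr0 addr0.
  split=> //; last by apply/eqP; rewrite -subr_eq0 [_ * _%:R]mulrC E0.
  apply: contraNneq yt => t0; move/eqP: E0; rewrite t0 mul0r subr0 mulf_eq0.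
  by rewrite pnatr_eq0.
- move=> j ij; rewrite nbr_upd //; [|lia|lia].
  by rewrite /Y1 /upd ifF; [apply: H; lia | lia].
Qed.

(* [D] stands for [DY lam]. *)
Variables (T : Type) (D : (nat -> {poly K}) -> T).
Hypothesis eq_D : forall Y Y', (forall i, (1 <= i <= r)%N -> Y i = Y' i) -> D Y = D Y'.
Hypothesis D_reproduce : forall Y i z kappa, (1 <= i <= r)%N ->
  good Y -> z != 0 -> kappa != 0 ->
  Y i * z^`() - (Y i)^`() * z = kappa *: ('X^(lb i) * nbr Y i) ->
  D Y = D (upd Y i z).

(* Reproduction in direction [i] turns [Y i] into [x^(N+1) (x - s)] with
   [N = lambda_i + e], after which the directions [i.+1, .., r] are treated by
   induction, and a second reproduction in direction [i] leads to a power of [x].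
   The induction breaks down if [s = 0], that is if [Y i.+1] vanishes at 0; then
   the lemma for [i.+2] and [e = 1] contradicts the Bethe equation at the other
   root of [Y i.+1]. *)
Lemma quad_tail n i : (r - i <= n)%N -> (1 <= i <= r)%N ->
  forall Y e q, good Y -> quads Y i -> Y i.-1 = 'X^e * ('X - q%:P) -> q != 0 ->
  bethe_at (lb i + e) (Y i) (('X - q%:P) * rnb Y i) ->
  (forall j, (i < j <= r)%N -> bethe_at (lb j) (Y j) (nbr Y j)) ->
  let a := (lb i + e + \sum_(i.+1 <= j < r.+1) lb j + (r - i).+1)%N in
  q * (hat Y i)^`().[q] = a.*2%:R * (hat Y i).[q] /\
  D Y = D (tail Y i a).
Proof.
(* The first conclusion says that at [q] the entry [i], squared for [i = r], has the logarithmic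
   derivative of [x^(2a)]. It is proved along because it ties [q] to the new root [s] one direction
   further left. The induction is strong since it is also applied at [i.+2]. *)
elim/ltn_ind: n i => n IH i ni ir Y e q G Q Yl q0 B H a.
have [ir'|ri] := ltnP i r; last first.
  have ? : i = r by lia. 
  subst i; have [_ [u hu]] := Q.
  have ea : a = (lb r + e).+1 by rewrite /a big_geq // subnn; lia.
  move: B; rewrite /rnb eqxx mulr1 hu => /bethe_linear [].
  rewrite derivXsubC !evalE => uq0 u0 E.
  have {}u0 : u != 0.
    by apply: contra_eq_neq E => ->; rewrite invr0 mulr0 mul0r add0r oner_neq0.
  have {}E : (lb r + e)%:R * (q - u) = u.
    have -> : (lb r + e)%:R * (q - u) = - u * ((lb r + e)%:R / u * (u - q)) by field.
    move/eqP: E; rewrite addr_eq0 => /eqP ->; by rewrite mulrNN mulr1.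
  move: ea E; set M := (lb r + e)%N => ea E.
  have M0 : M%:R != 0 :> K by apply: contraNneq u0 => Z; rewrite -E Z mul0r.
  have aq : a%:R * (q - u) = q by rewrite ea -natr1 mulrDl E mul1r addrC subrK.
  split.
    rewrite /hat eqxx hu expr2 derivM derivXsubC mul1r mulr1 !evalE -addnn natrD.
    by rewrite -{1}aq; ring.
  rewrite (@D_reproduce Y r 'X^a M%:R) ?expf_neq0 ?polyX_eq0 //; last first.
    rewrite /nbr /rnb eqxx mulr1 Yl hu derivXsubC derivXn ea mul1r /=.
    rewrite [in RHS]mulrA -exprD -/M -mulr_natr exprS -mul_polyC.
    have : (M.+1)%:R%:P * u%:P = M%:R%:P * q%:P :> {poly K}.
      by rewrite -!polyCM; congr (_%:P); rewrite -natr1 mulrDl mul1r -{2}E; ring.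
    rewrite !polyC_natr -natr1; move: (u%:P) (q%:P) ('X^M) => u' q' P e'.
    rewrite (_ : M%:R * (P * ('X - q')) = P * (M%:R * 'X - M%:R * q')); last by ring.
    by rewrite -e'; ring.
  apply: eq_D => j jr; rewrite /upd /tail; case: eqP => [->|jr']; first by rewrite leqnn.
  by rewrite ifF //; lia.
have ii : (i <= i < r)%N by lia.
have [s1 [s2 eh]] := hat_quads Q ii.
have [|p [p' [pp' eY]]] := Q.1 i; first lia.
move: B; rewrite /rnb ifF; last lia.
rewrite eh eY => B; have [A0 _ _] := bethe_quadratic B.
have [N0 p0 p'0 [s E]] := quad_step pp' B; move: (E).
rewrite -eY -eh => {}E; set N := (lb i + e)%N in N0 E.
have Nn : N%:R != 0 :> K by rewrite pnatr_eq0.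
have Ev t : (Y i).[t] * (N.+1%:R * (t - s) + t) - t * (Y i)^`().[t] * (t - s) =
  N%:R * ((t - q) * (hat Y i.+1).[t]).
  by have := congr1 (fun P => P.[t]) E; rewrite !evalE.
have y2 : (Y i)^`()^`() = 2%:P by rewrite eY deriv2_quadratic.
(* The derivative of [E]; at [t = s] the terms with the derivative of [Y i] cancel. *)
have Ed t : (Y i)^`().[t] * (N.+1%:R * (t - s) + t) + (Y i).[t] * N.+2%:R
   - ((Y i)^`().[t] * (t - s) + t * 2 * (t - s) + t * (Y i)^`().[t]) =
  N%:R * ((hat Y i.+1).[t] + (t - q) * (hat Y i.+1)^`().[t]).
  have := congr1 (fun P => P^`().[t]) E.
  rewrite !(derivXsubC, derivD, derivN, derivZ, derivM, derivX, derivC).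
  rewrite y2 !evalE -(natr1 N.+1) !mul1r => <-; ring.
have Y0 : (Y i).[0] != 0 by rewrite eY !evalE !sub0r mulf_neq0 ?oppr_eq0.
have H1 : bethe_at (lb i.+1) (Y i.+1) (Y i * rnb Y i.+1).
  by apply: H; rewrite ltnSn.
have Yroot t : root (Y i.+1) t -> (Y i).[t] != 0.
  move=> /H1 [A1 _ _].
  by move: A1; rewrite hornerM mulf_eq0 negb_or => /andP [].
have [Z|Z] := boolP (root (Y i.+1) 0).
  exfalso; have /rootP hz : root (hat Y i.+1) 0 by rewrite root_hat.
  have s0 : s = 0.
    have := Ev 0; rewrite hz !mul0r subr0 addr0 sub0r !mulr0 => /eqP.
    by rewrite !mulf_eq0 (negPf Y0) pnatr_eq0 oppr_eq0 => /eqP.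
  have [ir1|ir1] := ltnP i.+1 r; last first.
    (* Here [hat Y r] has a double zero at 0, so [Ed] at 0 reduces to [(N + 2) Y_i(0) = 0]. *)
    have er : i.+1 = r by apply/eqP; rewrite eqn_leq ir' ir1.
    have [_ [u hu]] := Q; have := Ed 0; rewrite hz s0 /hat er eqxx.
    move: Z; rewrite er hu root_XsubC => /eqP <-.
    rewrite expr2 derivM derivXsubC !evalE => /eqP.
    rewrite subr0 !(mulr0, mul0r, addr0, add0r, subr0) mulf_eq0 (negPf Y0) /=.
    by rewrite pnatr_eq0.
  have [q' [q'0 eq']] : exists q', q' != 0 /\ Y i.+1 = ('X - 0%:P) * ('X - q'%:P).
    have [|t [t' [tt' et]]] := Q.1 i.+1; first by rewrite leqnSn.
    move: Z tt'; rewrite et rootM !root_XsubC => /orP [] /eqP <-.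
      by move=> h; exists t'; rewrite eq_sym.
    by move=> h; exists t; rewrite mulrC.
  move: H1; rewrite eq' => H1.
  have [_ l0 _] := bethe_quadratic H1; rewrite eqxx orbF in l0.
  have [hq _ Eq] : [/\ (Y i).[q'] != 0, True & 2 * ((Y i).[q'] * (rnb Y i.+1).[q']) =
     q' * ((Y i)^`().[q'] * (rnb Y i.+1).[q'] + (Y i).[q'] * (rnb Y i.+1)^`().[q'])].
    split=> //; first by apply: Yroot; rewrite eq' rootM !root_XsubC eqxx orbT.
    move: H1; rewrite mulrC => /bethe_quadratic [_ _].
    by rewrite (eqP l0) subr0 !mul0r add0r !(evalE, derivM).
  have Rq : (rnb Y i.+1).[q'] != 0.
    move: H1; rewrite mulrC => /bethe_quadratic [A1 _ _].
    by move: A1; rewrite hornerM mulf_eq0 negb_or => /andP [].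
  have eR : rnb Y i.+1 = hat Y i.+2 by rewrite /rnb ltn_eqF.
  have Y2 : Y i.+1 = 'X^1 * ('X - q'%:P) by rewrite eq' polyC0 subr0 expr1.
  have B2 : bethe_at (lb i.+2 + 1) (Y i.+2) (('X - q'%:P) * rnb Y i.+2).
    apply: bethe_at_shift; rewrite mulrA -Y2.
    by apply: H; rewrite ltnW.
  have [lt2 i2] : (r - i.+2 < n)%N /\ (1 <= i.+2 <= r)%N.
    by move: ni ir ir1; clear; lia.
  have H2 j : (i.+2 < j <= r)%N -> bethe_at (lb j) (Y j) (nbr Y j) 
    by move=> ij; apply: H; move: ij; clear; lia.
  have Q2 : quads Y i.+2 by apply: quads_le Q; clear; lia.
  have [F _] := IH _ lt2 i.+2 (leqnn _) i2 Y 1%N q' G Q2 Y2 q'0 B2 H2.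
  have := Ev q'; have /rootP -> : root (hat Y i.+1) q'.
    by rewrite root_hat eq' rootM !root_XsubC eqxx orbT.
  rewrite s0 subr0 !mulr0 => /eqP; rewrite subr_eq0 => /eqP Eq2.
  have {Eq2} Eq2 : q' * (Y i)^`().[q'] = N.+2%:R * (Y i).[q'].
    by apply: (mulIf q'0); rewrite -Eq2 -(natr1 N.+1); ring.
  (* At [q'] the logarithmic derivatives of the neighbours are [(N + 2) / q'] by [Eq2] and [a2 / q']
     by [F], while the Bethe equation wants the sum [2 / q']. This forces [N + a2 = 0]. *)
  move: Eq; rewrite mulrDr [q' * (_ * _)]mulrA Eq2 [q' * (_ * _)]mulrCA eR F => /eqP.
  rewrite -subr_eq0; set a2 := (_.*2)%N; rewrite -eR.
  have -> : 2 * ((Y i).[q'] * (rnb Y i.+1).[q']) -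
     (N.+2%:R * (Y i).[q'] * (rnb Y i.+1).[q'] + (Y i).[q'] * (a2%:R * (rnb Y i.+1).[q']))
    = - ((N + a2)%:R * ((Y i).[q'] * (rnb Y i.+1).[q'])).
    by rewrite natrD -(natr1 N.+1) -(natr1 N); ring.
  rewrite oppr_eq0 !mulf_eq0 (negPf hq) (negPf Rq) !orbF pnatr_eq0.
  by rewrite addn_eq0 (negPf N0).
have s0 : s != 0.
  apply: contraNneq Z => s0; rewrite -root_hat; apply/rootP/eqP; have := Ev 0.
  rewrite s0 !(oppr0, subr0, mulr0, mul0r, addr0, sub0r) => /esym/eqP.
  by rewrite !mulf_eq0 (negPf Nn) oppr_eq0 (negPf q0).
pose z : {poly K} := 'X^(N.+1) * ('X - s%:P).
have z0 : z != 0 by rewrite mulf_neq0 ?expf_neq0 ?polyX_eq0 ?polyXsubC_eq0.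
pose Y1 := upd Y i z.
have [i1 _] := andP ir.
have G1 : good Y1 by apply: good_upd.
have eY1 : Y1 i.+1 = Y i.+1 by rewrite /Y1 /upd gtn_eqF.
have eh1 : hat Y1 i.+1 = hat Y i.+1 by rewrite hat_upd // gtn_eqF.
have sroot t : root (Y i.+1) t -> t != s.
  move=> rt; apply: contraNneq (Yroot t rt) => ts; move: rt; rewrite ts => rt.
  have := Ev s; have /rootP -> : root (hat Y i.+1) s by rewrite root_hat.
  by rewrite !subrr !mulr0 subr0 add0r => /eqP; rewrite mulf_eq0 (negPf s0) orbF.
have B1 : bethe_at (lb i.+1 + N.+1) (Y1 i.+1) (('X - s%:P) * rnb Y1 i.+1).
  rewrite eY1 rnb_upd //; last by rewrite gtn_eqF.
  apply: bethe_transfer H1 _ => t rt; have t0 : t != 0 by apply: contraNneq Z => <-.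
  split=> //; first by rewrite !evalE subr_eq0 sroot.
  rewrite derivXsubC !evalE mulr1; apply/eqP; rewrite -subr_eq0 Ev.
  have /rootP -> : root (hat Y i.+1) t by rewrite root_hat.
  by rewrite !mulr0.
have Yl1 : Y1 i.+1.-1 = 'X^(N.+1) * ('X - s%:P) by rewrite /Y1 /upd eqxx.
have [lt2 i2] : (r - i.+1 < n)%N /\ (1 <= i.+1 <= r)%N.
  by move: ni ir'; clear; lia.
have H2 j : (i.+1 < j <= r)%N -> bethe_at (lb j) (Y1 j) (nbr Y1 j).
  move=> ij; have [e1 e2 e3 e4] : [/\ j.-1 != i, j.+1 != i, j != i & (i < j <= r)%N].
    by clear -ij; split; lia.
  by rewrite nbr_upd // /Y1 /upd (negPf e3); apply: H.
have [F DE] := IH _ lt2 i.+1 (leqnn _) i2 Y1 N.+1 s G1 (quads_upd _ ir' Q) Yl1 s0 B1 H2.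
set a1 := (X in X.*2) in F.
(* The exponent is common to all directions: passing to [i.+1] moves [lb i] and one unit into the
   new [e]. *)
have ea : a1 = a.
  rewrite /a1 /a [in RHS]big_ltn // /N.
  by move: (lb i) (lb i.+1) (bigop _ _ _) ir'; clear; lia.
rewrite eh1 ea in F; rewrite -/a1 ea in DE.
have hs : (hat Y i.+1).[s] != 0.
  by apply/eqP => /rootP; rewrite root_hat => /sroot; rewrite eqxx.
(* [Ev] and [Ed] at [s] both determine the value of [Y i] there; eliminating it, with [F] for the
   derivative of [hat Y i.+1], leaves a relation between [q], [s] and [a]. *)
have REL : N.+2%:R * (s - q) = s + a.*2%:R * (s - q).
  have := Ed s; rewrite subrr !mulr0 !add0r; have := Ev s;
    rewrite subrr !mulr0 subr0 add0r.
  move=> E1 E2; apply: (mulIf (mulf_neq0 Nn hs)).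
  have -> : N.+2%:R * (s - q) * (N%:R * (hat Y i.+1).[s]) =
    N.+2%:R * (N%:R * ((s - q) * (hat Y i.+1).[s])) by ring.
  rewrite -E1.
  have -> : N.+2%:R * ((Y i).[s] * s) = s * ((Y i)^`().[s] * s + (Y i).[s] * N.+2%:R - s * (Y i)^`().[s]) by ring.
  rewrite E2 [s * (_ * _)]mulrCA mulrDr [s * (_ * _)]mulrCA F; ring.
have qs : q - s != 0.
  apply: contraNneq s0 => /eqP; rewrite subr_eq0 => /eqP e1.
  by move: REL; rewrite e1 subrr !mulr0 addr0 => <-.
split.
  rewrite {1 2}/hat (ltn_eqF ir'); apply: (mulIf qs); have := Ev q;
    rewrite subrr mul0r mulr0 => /eqP.
  rewrite subr_eq0 => /eqP <-.
  have -> : N.+1%:R * (q - s) + q = a.*2%:R * (q - s).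
    apply/eqP; rewrite -subr_eq0; move/eqP: REL; rewrite -subr_eq0 => /eqP REL.
    by rewrite -oppr0 -REL -(natr1 N.+1); apply/eqP; ring.
  by ring.
have aN : (N.+2 <= a)%N.
  by rewrite /a -/N -addnA -[N.+2]addn2 leq_add2l (leq_trans _ (leq_addl _ _)) // ltnS subn_gt0.
have eaN : a.*2%:R = (a.*2 - N.+2)%:R + N.+2%:R :> K.
  by rewrite -natrD subnK // (leq_trans aN) // -addnn leq_addr.
have kap : (a.*2 - N.+2)%:R != 0 :> K.
  by rewrite pnatr_eq0; move: aN; clear; lia.
(* [REL] rearranged into the hypothesis of [down_wronskian], with [k = 2a - (N + 2)]. *)
have KAP : (a.*2 - N.+2)%:R * q = (a.*2 - N.+2).+1%:R * s.
  apply/eqP; rewrite -subr_eq0 -natr1; move: REL => /eqP; rewrite -subr_eq0 => /eqP.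
  by move: eaN => -> REL; rewrite -REL; apply/eqP; ring.
have z' : z^`() = 'X^N * (N.+1%:R *: ('X - s%:P) + 'X).
  rewrite /z derivM derivXn derivXsubC mulr1 -scaler_nat -!mul_polyC /= exprSr.
  by move: (N.+1%:R%:P) ('X^N) => k P; ring.
rewrite (@D_reproduce Y i z N%:R) //; last first.
  rewrite /nbr /rnb (ltn_eqF ir') Yl z' -!mulrA [in RHS]mulrA -exprD -/N.
  rewrite [in RHS]scalerAr -E /z exprS -!mul_polyC.
  by move: (N.+1%:R%:P) ('X^N) => k P; ring.
rewrite -/Y1 DE; pose Y2 := tail Y1 i.+1 a.
have G2 : good Y2.
  by have [Y10 Y100] := G1; split=> [j|] //; rewrite /Y2 /tail; do 2?case: ifP;
    rewrite ?expf_neq0 ?polyX_eq0.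
have Y2i : Y2 i = z by rewrite /Y2 /tail ltnn /Y1 /upd eqxx.
have Y2p : Y2 i.-1 = Y i.-1.
  rewrite /Y2 /tail /Y1 /upd; have -> : (i < i.-1)%N = false by move: i1; clear; lia.
  by have -> : (i.-1 == i)%N = false by move: i1; clear; lia.
have Y2h : hat Y2 i.+1 = 'X^(a.*2).
  rewrite /hat /Y2 /tail ir' eqxx; case: eqP => [e1|/eqP/negPf e1]; last by rewrite leqnn.
  by rewrite -exprM muln2.
(* The way back: the right neighbour is now [x^(2a)], and a second reproduction in direction [i]
   takes [z] to the same power. *)
rewrite -/Y2 (@D_reproduce Y2 i 'X^(a.*2) (a.*2 - N.+2)%:R) ?expf_neq0 ?polyX_eq0 //;
  last first.
  rewrite /nbr /rnb (ltn_eqF ir') Y2p Y2h Y2i Yl z' derivXn /z.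
  have -> : 'X^(lb i) * ('X^e * ('X - q%:P) * 'X^(a.*2)) = 'X^N * ('X - q%:P) * 'X^(a.*2) :> {poly K}.
    by rewrite !mulrA -exprD.
  have ea2 : a.*2 = a.*2.-1.+1 by rewrite prednK // double_gt0 (leq_trans _ aN).
  have -> : 'X^(a.*2.-1) *+ a.*2 = a.*2%:R%:P * 'X^(a.*2.-1) :> {poly K}.
    by rewrite polyC_natr -mulr_natl.
  have -> : 'X^(a.*2) = 'X * 'X^(a.*2.-1) :> {poly K} by rewrite -exprS -ea2.
  rewrite exprS -!mul_polyC eaN -(natr1 N.+1) !polyCD.
  have := congr1 polyC KAP; rewrite !polyCM -natr1 polyCD => e'.
  exact: down_wronskian e'.
apply: eq_D => j jr; rewrite /upd /Y2 /tail /Y1 /upd; case: eqP => [->|/eqP ji].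
  by rewrite leqnn (ltn_eqF ir').
by move: ji; rewrite neq_ltn => /orP [] ij;
  [rewrite [(i < j)%N]ltnNge (ltnW ij) [(i <= j)%N]leqNgt ij | rewrite ij (ltnW ij)].
Qed.

(** [Y] stays the tuple whose Bethe equations are known, while [W] holds the entries already
    replaced. The condition at the root of [Y k] lets [x^b] stand in for [hat Y k.+1] in the Bethe
    equation of direction [k]. *)
Lemma linear_descent k : (k < r)%N ->
  forall Y (W : nat -> {poly K}) b, good Y -> (forall j, W j != 0) ->
  (forall j, (1 <= j <= k)%N -> exists t, Y j = 'X - t%:P) ->
  (forall j, (1 <= j <= k)%N -> bethe_at (lb j) (Y j) (nbr Y j)) ->
  hat W k.+1 = 'X^b ->
  (forall t, root (Y k) t ->
     t != 0 /\ t * (hat Y k.+1)^`().[t] = b%:R * (hat Y k.+1).[t]) ->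
  D Y = D (fun j => if (k < j)%N then W j else Y j) ->
  D Y = D (fun j => if (k < j)%N then W j
                    else 'X^(b + \sum_(j <= m < k.+1) lb m + (k.+1 - j))).
Proof.
elim: k => [|k IH] kr Y W b G W0 L H hW B DE.
  by rewrite DE; apply: eq_D => j; case: j.
have [Yn Y00] := G.
have kk : (1 <= k.+1 <= k.+1)%N by rewrite leqnn.
have [t et] := L _ kk.
(* For [k = 0] the left neighbour is ['X - 1], so direction 1 needs no separate treatment. *)
have [q eq] : exists q, Y k = 'X - q%:P.
  case: (posnP k) => [->|k0]; first by exists 1.
  by apply: L; rewrite k0 ltnW /=.
have rt : root (Y k.+1) t by rewrite et root_XsubC.
have [t0 Bt] := B t rt.
have := H _ kk; rewrite /nbr /rnb (ltn_eqF kr) et eq => /bethe_linear [].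
rewrite !(evalE, derivM) derivXsubC mulf_eq0 negb_or => /andP [tq R0] _.
set R := hat Y k.+2 in R0 Bt *; rewrite hornerC mul1r => E.
pose M := (lb k.+1 + b)%N.
have {}E : M%:R * (q - t) = t.
  apply: (mulIf R0); rewrite /M natrD.
  have -> : ((lb k.+1)%:R + b%:R) * (q - t) * R.[t] = t * R.[t] -
    t * ((lb k.+1)%:R / t * ((t - q) * R.[t]) + (R.[t] + (t - q) * R^`().[t]))
    + (t - q) * (t * R^`().[t] - b%:R * R.[t]) by field.
  by rewrite E Bt subrr !mulr0 addr0 subr0.
have M0 : M%:R != 0 :> K by apply: contraNneq t0 => M0; rewrite -E M0 mul0r.
(* Equivalently, [x - t] has at [q] the logarithmic derivative of [x^(M+1)]: this is the condition
   for the next direction. *)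
have Mq : M.+1%:R * (q - t) = q by rewrite -natr1 mulrDl E mul1r addrC subrK.
have q0 : q != 0.
  apply: contraNneq t0 => q0; move: Mq => /eqP; rewrite q0 sub0r mulf_eq0 pnatr_eq0.
  by rewrite oppr_eq0.
pose W' j := if j == k.+1 then 'X^(M.+1) else W j.
have kr' : (k < r)%N by apply: ltnW.
pose Y2 j := if (k.+1 < j)%N then W j else Y j.
have G2 : good Y2 by split=> // j; rewrite /Y2; case: ifP.
have Y2k : Y2 k.+1 = 'X - t%:P by rewrite /Y2 ltnn.
have Y2k' : Y2 k = 'X - q%:P by rewrite /Y2 ltnNge leqnSn.
have Y2h : hat Y2 k.+2 = 'X^b by rewrite -hW /hat /Y2 ltnSn; case: eqP => // <-;
  rewrite ltnSn.
have kr1 : (1 <= k.+1 <= r)%N by [].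
have DE' : D Y = D (fun j => if (k < j)%N then W' j else Y j).
  rewrite DE -/Y2 (@D_reproduce Y2 k.+1 'X^(M.+1) M%:R) ?expf_neq0 ?polyX_eq0 //;
    last first.
    rewrite /nbr /rnb (ltn_eqF kr) Y2h /= Y2k' Y2k derivXsubC derivXn mul1r /=.
    have -> : 'X^(lb k.+1) * (('X - q%:P) * 'X^b) = 'X^M * ('X - q%:P) :> {poly K}.
      by rewrite /M exprD; move: ('X^(lb k.+1)) ('X^b) => P P'; ring.
    rewrite -scaler_nat -!mul_polyC exprS.
    have : M%:R%:P * q%:P = M.+1%:R%:P * t%:P :> {poly K}.
      by rewrite -!polyCM -(natr1 M) mulrDl mul1r -{2}E; congr (_%:P); ring.
    rewrite -(natr1 M) polyCD; move: (M%:R%:P) (q%:P) (t%:P) ('X^M) => m q' t' P e.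
    transitivity (P * (m * 'X - (m + 1) * t')); first by ring.
    by rewrite -e; ring.
  apply: eq_D => j _; rewrite /upd /Y2 /W'; case: eqP => [->|/eqP jk];
    first by rewrite ltnSn.
  by have -> : (k < j)%N = (k.+1 < j)%N by move: jk; clear; lia.
rewrite (IH kr' Y W' M.+1 G _ _ _ _ _ DE').
- apply: eq_D => j _; rewrite /W'; case: ltnP => [kj|jk].
    case: eqVneq => [->|jk].
      rewrite ltnn big_nat1 subSnn; congr ('X^_).
      by rewrite /M; move: (lb _); clear; lia.
    by have -> : (k.+1 < j)%N by move: kj jk; clear; lia.
  rewrite ltnNge (leq_trans jk) //=; congr ('X^_); rewrite [in RHS]big_nat_recr /=;
    last by rewrite leqW.
  by move: jk; rewrite /M; move: (lb _) (bigop _ _ _); clear; lia.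
- by move=> j; rewrite /W'; case: ifP => // _; rewrite expf_neq0 ?polyX_eq0.
- by move=> j /andP [j1 jk]; apply: L; rewrite j1 ltnW.
- by move=> j /andP [j1 jk]; apply: H; rewrite j1 ltnW.
- by rewrite /hat /W' eqxx (ltn_eqF kr).
move=> u; rewrite eq root_XsubC => /eqP ->; split=> //.
by rewrite /hat (ltn_eqF kr) et derivXsubC !evalE mulr1 Mq.
Qed.

Lemma descent_short l : (l < r)%N ->
  forall Y, good Y ->
  (forall j, (1 <= j <= l)%N -> exists t, Y j = 'X - t%:P) ->
  (forall j, (l < j <= r)%N -> Y j = 1) ->
  (forall j, (1 <= j <= l)%N -> bethe_at (lb j) (Y j) (nbr Y j)) ->
  D Y = D (fun j => 'X^(expo lam l j)).
Proof.
move=> lr Y G L L1 H.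
have h1 : hat Y l.+1 = 1.
  by rewrite /hat; case: eqP => [_|_]; rewrite L1 ?expr1n // ?ltnSn // lr leqnn.
rewrite (@linear_descent l lr Y (fun _ => 1) 0) //; first last.
- by apply: eq_D => j jr; case: ltnP => // lj; apply: L1; rewrite lj; case/andP: jr.
- move=> t rt; rewrite h1 derivC horner0 mulr0 mul0r; split=> //.
  case: (posnP l) rt => [->|l0]; first by rewrite G.2 root_XsubC => /eqP ->;
    rewrite oner_eq0.
  have ll : (1 <= l <= l)%N by rewrite l0 leqnn.
  have [t' et] := L l ll; rewrite et root_XsubC => /eqP ->.
  have := H l ll; rewrite /nbr /rnb (ltn_eqF lr) h1 mulr1 et => /bethe_linear [_ _].
  have [q ->] : exists q, Y l.-1 = 'X - q%:P.
    case: (posnP l.-1) => [->|l1]; first by exists 1; apply: G.2.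
    by apply: L; rewrite l1 leq_pred.
  (* By the convention [0^-1 = 0], the equation would read [1 = 0] for a root at 0. *)
  rewrite derivXsubC hornerC => E; apply: contra_eq_neq E => ->.
  by rewrite invr0 mulr0 mul0r add0r oner_neq0.
- by rewrite /hat; case: eqP => _; rewrite ?expr1n expr0.
- by move=> _; apply: oner_neq0.
apply: eq_D => j jr; rewrite /expo lr; case: ltnP => // jl.
by congr ('X^_); move: (bigop _ _ _) jl; clear; lia.
Qed.

(** Here [k] is the number of ones in front, so the length is [k + 2 (r - 1 - k) + 1]. The first
    conclusion of [quad_tail] starts the descent through the linear entries. *)
Lemma descent_long k : (k < r)%N ->
  forall Y, good Y ->
  (forall j, (1 <= j <= k)%N -> exists t, Y j = 'X - t%:P) ->
  quads Y k.+1 ->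
  (forall j, (1 <= j <= r)%N -> bethe_at (lb j) (Y j) (nbr Y j)) ->
  D Y = D (fun j => 'X^(expo lam (2 * r - 1 - k) j)).
Proof.
move=> kr Y G L Q H.
have kr1 : (1 <= k.+1 <= r)%N by [].
have [q eq] : exists q, Y k = 'X - q%:P.
  case: (posnP k) => [->|k0]; first by exists 1; apply: G.2.
  by apply: L; rewrite k0 leqnn.
have Hk := H _ kr1.
have H' j : (k.+1 < j <= r)%N -> bethe_at (lb j) (Y j) (nbr Y j).
  by move=> /andP [kj jr]; apply: H; rewrite jr (leq_trans _ kj).
(* Otherwise the left neighbour of direction [k.+1] would be the pure power [x^1]. *)
have q0 : q != 0.
  apply/eqP => q0; apply: (bethe_tail_contra (leqnn _) kr1 (ltn0Sn 0) Q _ H').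
  by apply: bethe_at_shift; move: Hk; rewrite /nbr /= eq q0 subr0 expr1.
have Yk : Y k.+1.-1 = 'X^0 * ('X - q%:P) by rewrite expr0 mul1r.
have B0 : bethe_at (lb k.+1 + 0) (Y k.+1) (('X - q%:P) * rnb Y k.+1).
  by rewrite addn0; move: Hk; rewrite /nbr /= eq.
have [] := quad_tail (leqnn _) kr1 G Q Yk q0 B0 H'.
set a := (_ + _ + _ + _)%N => F DE.
rewrite (@linear_descent k kr Y (tail Y k.+1 a) a.*2) //; first last.
- by rewrite DE; apply: eq_D => j _; rewrite /tail; case: ifP.
- by move=> t; rewrite eq root_XsubC => /eqP ->.
- rewrite /hat /tail kr leqnn; case: eqP => [_|_]; last by [].
  by rewrite eqxx -exprM muln2.
- by move=> j jk; apply: H; move: jk kr; clear; lia.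
- by move=> j; rewrite /tail; case: ifP => _; [rewrite expf_neq0 ?polyX_eq0 | apply: G.1].
have ea : a = (\sum_(k.+1 <= j < r.+1) lb j + (r - k))%N.
  rewrite /a addn0 [in RHS]big_ltn //; move: (lb _) (bigop _ _ _) kr; clear; lia.
apply: eq_D => j /andP [_ jr]; rewrite /expo /tail {a F DE}ea.
have -> : (2 * r - 1 - k < r)%N = false by move: kr; clear; lia.
case: (eqVneq (2 * r - 1 - k)%N r) => [er|ner].
  have ek : k = r.-1 by move: er kr; clear; lia.
  have r1 : r.-1.+1 = r by move: kr; clear; lia.
  subst k; rewrite !r1 big_nat1; case: ltnP => [rj|rj].
    by congr ('X^_); move: (lb _) (bigop _ _ _) r1 rj; clear; lia.
  have -> : j = r by move: rj jr; clear; lia.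
  by rewrite eqxx; congr ('X^_); move: (lb _) r1; clear; lia.
have -> : (2 * r - (2 * r - 1 - k) - 1 = k)%N by move: kr; clear; lia.
case: ltnP => kj.
  rewrite ltn_neqAle jr andbT; case: eqP => _ /=; congr ('X^_);
  move: (bigop _ _ _) kr; clear; lia.
by congr ('X^_); move: (bigop _ _ _) (bigop _ _ _) kr kj; clear; lia.
Qed.

End Chain.

(** * The tuple of a solution of the Bethe equations *)

Section RootSystem.
Variable r : nat.
Implicit Types u v w : weight r.

Lemma wdotC u v : wdot u v = wdot v u.
Proof. by apply: eq_bigr => j _; rewrite mulrC. Qed.

Lemma wdotDl u v w : wdot (u + v) w = wdot u w + wdot v w.
Proof. by rewrite /wdot -big_split; apply: eq_bigr => j _; rewrite mxE mulrDl. Qed.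

Lemma wdotNl u w : wdot (- u) w = - wdot u w.
Proof. by rewrite /wdot -sumrN; apply: eq_bigr => j _; rewrite mxE mulNr. Qed.

Lemma wdotDr u v w : wdot w (u + v) = wdot w u + wdot w v.
Proof. by rewrite wdotC wdotDl !(wdotC w). Qed.

Lemma wdotNr u w : wdot w (- u) = - wdot w u.
Proof. by rewrite wdotC wdotNl (wdotC w). Qed.

Lemma wdot_eps a b : wdot (eps r a) (eps r b) = ((a == b) && (0 < a <= r)%N)%:R.
Proof.
have e j : eps r a 0 j * eps r b 0 j = ((j.+1 == a) && (j.+1 == b))%:R.
  by rewrite !mxE; do 2!case: eqP.
rewrite /wdot (eq_bigr _ (fun j _ => e j));
  have [/andP [a0 ar]|ar] := boolP (0 < a <= r)%N; last first.
  rewrite andbF big1 // => j _.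
  by have -> : (j.+1 == a) = false by move: (ltn_ord j) ar; clear; lia.
have ar' : (a.-1 < r)%N by move: a0 ar; clear; lia.
rewrite (bigD1 (Ordinal ar')) //= prednK // eqxx big1 ?addr0 ?andbT // => j.
rewrite -val_eqE /= => ja; have -> : (j.+1 == a) = false by move: ja a0; clear; lia.
by [].
Qed.

(** Half the squared length of the simple root; it is a common factor of all terms of a Bethe
    equation. *)
Definition hlen j : nat := if j == r then 2 else 1.

Lemma sroot_coroot j : sroot r j = scoroot r j *+ hlen j.
Proof. by rewrite /sroot /scoroot /hlen; case: eqP. Qed.

Lemma wdot_sroot j k : (1 <= j <= r)%N -> (1 <= k <= r)%N ->
  wdot (sroot r j) (sroot r k) = (hlen j)%:R *
    ((k == j)%:R *+ 2 - (k.+1 == j)%:R - (k == j.+1)%:R *+ (if j.+1 == r then 2 else 1)).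
Proof.
move=> jr kr; rewrite /sroot /hlen !mulr2n.
by case: (eqVneq j r) => ej; case: (eqVneq k r) => ek;
   rewrite !(wdotDl, wdotDr, wdotNl, wdotNr, wdot_eps) !natz;
     case: (eqVneq j.+1 r) => ej1;
   rewrite ?mulr2n ?mulr1n; lia.
Qed.

Lemma wdot_sroot_fweight1 j : (2 <= r)%N -> (1 <= j <= r)%N ->
  wdot (sroot r j) (fweight r 1) = (j == 1%N)%:R.
Proof.
move=> r2 jr; rewrite /sroot /fweight big_nat1 mulr2n.
by case: (eqVneq j r) => ej; rewrite !(wdotDl, wdotNl, wdot_eps) !natz; lia.
Qed.

Lemma wdot_sroot_dominant j lam : dominant lam -> (1 <= j <= r)%N ->
  wdot (sroot r j) lam = (hlen j)%:R * (label lam j)%:Z.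
Proof.
move=> dom jr; rewrite sroot_coroot wdotC /label gez0_abs ?dom // /hlen mulrC.
by case: (j == r); rewrite ?mulr2n ?wdotDr ?mulr1 // mulrDr mulr1.
Qed.

End RootSystem.

Section LogDer.
Variable K : fieldType.
Implicit Types P Q : {poly K}.

Definition ld P p := P^`().[p] / P.[p].

Lemma ldM P Q p : P.[p] != 0 -> Q.[p] != 0 -> ld (P * Q) p = ld P p + ld Q p.
Proof. by move=> P0 Q0; rewrite /ld derivM !evalE; field; rewrite P0 Q0. Qed.

Lemma ld_prod (I : finType) (A : pred I) (t : I -> K) p :
  (forall k, A k -> p != t k) ->
  (\prod_(k | A k) ('X - (t k)%:P)).[p] != 0 /\
  ld (\prod_(k | A k) ('X - (t k)%:P)) p = \sum_(k | A k) (p - t k)^-1.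
Proof.
move=> h; elim/big_rec2: _ => [|k s P Ak [P0 <-]].
  by rewrite /ld derivC horner0 mul0r hornerC oner_neq0.
have pk : ('X - (t k)%:P).[p] != 0 by rewrite hornerXsubC subr_eq0 h.
by rewrite hornerM mulf_neq0 // ldM //; split=> //;
  rewrite /ld derivXsubC hornerC hornerXsubC mul1r.
Qed.

End LogDer.

Section Solution.
Variables (K : numFieldType) (r : nat) (lam : weight r) (l : nat -> nat).
Hypotheses (r3 : (3 <= r)%N) (dom : dominant lam).
Variables (c : 'I_(tuple_length r l) -> nat) (t : 'I_(tuple_length r l) -> K).
Hypothesis hc : coloring c.
Hypothesis ht : bethe_solution (tnth [tuple lam; fweight r 1]) (tnth [tuple 0; 1]) c t.

(** The weight [omega_1] at the point 1 acts on direction 1 like a root of an additional entry 0. *)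
Definition btuple j : {poly K} := if j == 0%N then 'X - 1%:P else bethe_poly c t j.

Lemma btuple_neq0 j : btuple j != 0.
Proof.
rewrite /btuple /bethe_poly; case: ifP => _; first by rewrite polyXsubC_eq0.
by rewrite prodf_seq_neq0; apply/allP => k _; rewrite polyXsubC_eq0 implybT.
Qed.

Lemma btuple_shape0 j : (1 <= j <= r)%N -> l j = 0%N -> btuple j = 1.
Proof.
move=> jr l0; have [_ _ /(_ j jr)] := hc; rewrite l0 => /eqP; rewrite cards_eq0 => /eqP e.
rewrite /btuple /bethe_poly gtn_eqF; last by case/andP: jr.
by apply: big_pred0 => k; have := in_set0 k; rewrite -e inE.
Qed.

Lemma btuple_shape1 j : (1 <= j <= r)%N -> l j = 1%N -> exists a, btuple j = 'X - a%:P.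
Proof.
move=> jr l1; have [_ _ /(_ j jr)] := hc; rewrite l1 => /eqP/cards1P [k e].
exists (t k); rewrite /btuple /bethe_poly gtn_eqF; last by case/andP: jr.
by rewrite (big_pred1 k) // => k'; have := in_set1 k' k; rewrite -e inE.
Qed.

Lemma same_color i k : c k = c i -> k != i -> t i != t k.
Proof.
have [cr _ _] := hc; have [_ h _] := ht => e ki; apply: h => //.
rewrite e wdot_sroot ?cr // eqxx; have := cr i; rewrite /hlen; case: ifP => _; clear; lia.
Qed.

Lemma btuple_shape2 j : (1 <= j <= r)%N -> l j = 2 ->
  exists p q, p != q /\ btuple j = ('X - p%:P) * ('X - q%:P).
Proof.
move=> jr l2; have [_ _ /(_ j jr)] := hc; rewrite l2 => /eqP/cards2P [k [k' [kk' e]]].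
have h i : (c i == j) = (i == k) || (i == k').
  by have := in_set2 i k k'; rewrite -e inE.
have ck : c k = j by apply/eqP; rewrite h eqxx.
have ck' : c k' = j by apply/eqP; rewrite h eqxx orbT.
exists (t k), (t k'); split; first by apply: same_color; rewrite ?ck ?ck' // eq_sym.
rewrite /btuple /bethe_poly gtn_eqF; last by case/andP: jr.
rewrite (bigD1 k) ?ck //= (big_pred1 k') // => i; rewrite /= h.
by case: (eqVneq i k) => [->|_]; rewrite ?andbF ?andbT //= ?orbT (negPf kk').
Qed.

(** For [y = (x - p) G] the quotient [y'' / y'] at [p] is [2 G' / G], twice the sum over the other
    roots of the same colour. Division of the Bethe equation by [hlen] leaves the label and the
    Cartan integers, which are the exponents in [nbr]. *)
Lemma btuple_bethe_at j : (1 <= j <= r)%N ->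
  bethe_at (label lam j) (btuple j) (nbr r btuple j).
Proof.
move=> jr p; have j0 : (j == 0%N) = false by move: jr; clear; lia.
have [cr _ _] := hc; have [hz hd hb] := ht.
rewrite {1}/btuple j0 /bethe_poly rootE horner_prod prodf_seq_eq0 => /hasP [i _ /andP [ci]].
rewrite hornerXsubC subr_eq0 => /eqP ep; subst p; set p := t i.
move/eqP in ci.
have r2 : (2 <= r)%N by apply: ltnW.
have := hb i; rewrite big_ord_recl big_ord1 !(tnth_nth 0) /= subr0 ci.
rewrite (wdot_sroot_dominant dom jr) wdot_sroot_fweight1 //.
pose S a := \sum_(k | c k == a) (p - t k)^-1.
pose S' := \sum_(k | (c k == j) && (k != i)) (p - t k)^-1.
pose m : nat := if j.+1 == r then 2 else 1.
pose h := hlen r j.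
have sumb (A B : pred 'I_(tuple_length r l)) f :
    \sum_(k | A k) (B k)%:R * f k = \sum_(k | A k && B k) f k :> K.
  by rewrite big_mkcondr; apply: eq_bigr => k _; case: (B k); rewrite ?mul1r ?mul0r.
have sumi a : a != j -> \sum_(k | (k != i) && (c k == a)) (p - t k)^-1 = S a.
  move=> aj; apply: eq_bigl => k; case: (eqVneq k i) => //= ->.
  by rewrite ci eq_sym (negPf aj).
have -> : \sum_(k < tuple_length r l | k != i)
   (wdot (sroot r j) (sroot r (c k)))%:~R / (p - t k)
   = h%:R * (S' *+ 2 - S j.-1 - S j.+1 *+ m).
  have e k : (wdot (sroot r j) (sroot r (c k)))%:~R / (p - t k) =
     h%:R * ((c k == j)%:R * (p - t k)^-1 *+ 2 - (c k == j.-1)%:R * (p - t k)^-1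
       - (c k == j.+1)%:R * (p - t k)^-1 *+ m).
    rewrite wdot_sroot ?cr // -/h -/m.
    have -> : ((c k).+1 == j) = (c k == j.-1) by move: jr; clear; lia.
    by rewrite !(rmorphM, rmorphB, rmorphMn, rmorph_nat) -mulrA !mulrBl !mulrnAl.
  rewrite (eq_bigr _ (fun k _ => e k)) -mulr_sumr !sumrB !sumrMnl !sumb;
    congr (_ * (_ *+ 2 - _ - _ *+ _)).
  - by apply: eq_bigl => k; rewrite andbC.
  - by apply: sumi; move: jr; clear; lia.
  - by apply: sumi; clear; lia.
move=> E.
have h0 : h%:R != 0 :> K by rewrite /h /hlen; case: (j == r); rewrite pnatr_eq0.
have {}E : S' *+ 2 = (label lam j)%:R / p + ((j == 1%N)%:R / (p - 1) + S j.-1) + S j.+1 *+ m.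
  have e1 : (j == 1%N)%:R / (p - 1) = h%:R * ((j == 1%N)%:R / (p - 1)) :> K.
    case: (eqVneq j 1%N) => [j1|_]; last by rewrite !mul0r mulr0.
    by rewrite /h /hlen j1 (ltn_eqF r2) mulr1n !mul1r.
  rewrite rmorphM /= !rmorph_nat -pmulrn e1 -/p -/h in E.
  apply: (mulfI h0); move: E; move: (S' *+ 2) (_ *+ m) (_ / (p - 1)) => s1 s2 q1 E.
  by apply/eqP; rewrite -subr_eq0; apply/eqP; rewrite -[RHS]E; ring.
have Sout a : (forall k, c k != a) -> S a = 0.
  by move=> ca; apply: big_pred0 => k; apply/negbTE.
have noti a k : a != j -> wdot (sroot r j) (sroot r a) != 0 -> c k == a -> p != t k.
  move=> aj wa /eqP ck; apply: hd; rewrite ?ci ?ck //.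
  by apply: contraNneq aj => ki; rewrite -ck ki ci.
have [L0 Lld] : (btuple j.-1).[p] != 0 /\
    ld (btuple j.-1) p = (j == 1%N)%:R / (p - 1) + S j.-1.
  case: (eqVneq j 1%N) => [j1|j1].
    have p1 : p - 1 != 0.
      rewrite subr_eq0; apply: (hz i (lift ord0 ord0)).
      by rewrite (tnth_nth 0) /= ci wdot_sroot_fweight1 // j1.
    rewrite j1 /btuple /= hornerXsubC Sout ?addr0; last by move=> k; have := cr k;
      clear; lia.
    by rewrite /ld derivXsubC hornerC hornerXsubC mul1r.
  rewrite mul0r add0r /btuple; have -> : (j.-1 == 0%N) = false by move: jr j1; clear; lia.
  apply: ld_prod => k; apply: noti; first by move: jr; clear; lia.
  have jr' : (1 <= j.-1 <= r)%N by move: jr j1; clear; lia.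
  rewrite wdot_sroot //; have -> : (j.-1 == j) = false by move: jr; clear; lia.
  have -> : (j.-1.+1 == j) by move: jr; clear; lia.
  have -> : (j.-1 == j.+1) = false by clear; lia.
  by rewrite -/h !mul0rn sub0r subr0 mulrN1 oppr_eq0 /h /hlen; case: ifP.
have [R0 Rld] : (rnb r btuple j).[p] != 0 /\ ld (rnb r btuple j) p = S j.+1 *+ m.
  rewrite /rnb; case: (eqVneq j r) => [er|nr].
    rewrite hornerC oner_neq0 /ld derivC horner0 mul0r Sout ?mul0rn //.
    by move=> k; have := cr k; rewrite er; clear; lia.
  have jr' : (1 <= j.+1 <= r)%N by move: jr nr; clear; lia.
  have [B0 Bld] : (btuple j.+1).[p] != 0 /\ ld (btuple j.+1) p = S j.+1.
    apply: ld_prod => k; apply: noti; first by clear; lia.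
    rewrite wdot_sroot // eqxx; have -> : (j.+1 == j) = false by clear; lia.
    have -> : (j.+2 == j) = false by clear; lia.
    by rewrite !mul0rn subr0 sub0r mulrN oppr_eq0 mulf_neq0 // /hlen; case: ifP.
  rewrite /hat /m; case: (eqVneq j.+1 r) => [<-|_]; last by [].
  by rewrite expr2 hornerM mulf_neq0 // ldM // Bld mulr2n.
have A0 : (nbr r btuple j).[p] != 0 by rewrite hornerM mulf_neq0.
have Ald : (nbr r btuple j)^`().[p] =
    ((j == 1%N)%:R / (p - 1) + S j.-1 + S j.+1 *+ m) * (nbr r btuple j).[p].
  by rewrite -Lld -Rld -ldM // /ld divfK.
split=> //.
  apply/orP; case: (eqVneq (label lam j) 0%N) => [|l0]; [by left|right].
  apply: (hz i ord0); rewrite (tnth_nth 0) /= ci wdot_sroot_dominant //.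
  by rewrite mulf_neq0 // /hlen; case: ifP.
have [G0 Gld] : (\prod_(k | (c k == j) && (k != i)) ('X - (t k)%:P)).[p] != 0 /\
   ld (\prod_(k | (c k == j) && (k != i)) ('X - (t k)%:P)) p = S'.
  apply: ld_prod => k /andP [/eqP ck ki]; apply: same_color => //.
  by rewrite ck ci.
have -> : btuple j = ('X - p%:P) * \prod_(k | (c k == j) && (k != i)) ('X - (t k)%:P).
  by rewrite /btuple j0 /bethe_poly (bigD1 i) ?ci.
move: G0 Gld Ald; move: (\prod_(k | _) _) (nbr r btuple j) => G A G0 Gld Ald.
rewrite !(derivXsubC, derivM, derivD, derivC) !(horner0, evalE).
have -> : G^`().[p] = S' * G.[p] by rewrite -Gld /ld divfK.
rewrite Ald; transitivity (G.[p] * (S' *+ 2) * A.[p]); first by ring.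
by rewrite E; ring.
Qed.

End Solution.

(** * The symplectic Lie algebra *)

Section Symplectic.
Variables (K : numFieldType) (r : nat).
Implicit Types (A B C : 'M[K]_r) (X Y : 'M[K]_(r + r)).

Lemma tr_sub m n (A B : 'M[K]_(m, n)) : (A - B)^T = A^T - B^T.
Proof. exact: linearB. Qed.

Lemma tr_add m n (A B : 'M[K]_(m, n)) : (A + B)^T = A^T + B^T.
Proof. exact: linearD. Qed.

Definition spm A B C : 'M[K]_(r + r) := block_mx A B C (- A^T).

Lemma in_spE A B C D : in_sp (block_mx A B C D) <-> [/\ B^T = B, C^T = C & D = - A^T].
Proof.
rewrite /in_sp /Jmx tr_block_mx !mulmx_block !(mulmx0, mul0mx, mulmx1, mul1mx).
rewrite !(mulmxN, mulNmx, mulmx1, mul1mx, add0r, addr0) add_block_mx.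
rewrite -[0 in X in X <-> _](block_mx0 K r r r r); split.
  case/eq_block_mx => h1 h2 h3 h4; split.
  - by apply/eqP; rewrite -subr_eq0 h4.
  - by apply/eqP; rewrite eq_sym -subr_eq0 addrC h1.
  - by apply/eqP; rewrite -subr_eq0 opprK addrC h2.
by case=> -> -> ->; rewrite linearN /= trmxK opprK addNr !subrr.
Qed.

Lemma in_sp_spm A B C : B^T = B -> C^T = C -> in_sp (spm A B C).
Proof. by move=> eB eC; apply/in_spE. Qed.

Lemma in_spP X : in_sp X -> exists A B C, [/\ B^T = B, C^T = C & X = spm A B C].
Proof.
rewrite -[X]submxK => /in_spE [eB eC eD].
by exists (ulsubmx X), (ursubmx X), (dlsubmx X); rewrite /spm -eD.
Qed.

Lemma spm_lin a A B C A' B' C' :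
  a *: spm A B C + spm A' B' C' = spm (a *: A + A') (a *: B + B') (a *: C + C').
Proof.
by rewrite /spm scale_block_mx add_block_mx linearD /= linearZ /= scalerN opprD.
Qed.

Lemma lie_spm A B C A' B' C' : lie_br (spm A B C) (spm A' B' C') =
  block_mx (A *m A' + B *m C' - (A' *m A + B' *m C))
           (A *m B' - B *m A'^T - (A' *m B - B' *m A^T))
           (C *m A' - A^T *m C' - (C' *m A - A'^T *m C))
           (C *m B' + A^T *m A'^T - (C' *m B + A'^T *m A^T)).
Proof.
rewrite /lie_br /spm !mulmx_block opp_block_mx add_block_mx.
by rewrite !(mulmxN, mulNmx, opprK).
Qed.

Lemma in_sp_lin a X Y : in_sp X -> in_sp Y -> in_sp (a *: X + Y).
Proof.
move=> /in_spP [A [B [C [eB eC ->]]]] /in_spP [A' [B' [C' [eB' eC' ->]]]].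
by rewrite spm_lin; apply: in_sp_spm; rewrite linearD /= linearZ /= ?eB ?eB' ?eC ?eC'.
Qed.

Lemma in_sp0 : in_sp (0 : 'M[K]_(r + r)).
Proof. by rewrite /in_sp trmx0 mul0mx mulmx0 addr0. Qed.

Lemma in_sp_tr X : in_sp X -> in_sp X^T.
Proof.
move=> /in_spP [A [B [C [eB eC ->]]]]; rewrite tr_block_mx eB eC.
by apply/in_spE; split=> //; rewrite linearN.
Qed.

Lemma in_sp_lie X Y : in_sp X -> in_sp Y -> in_sp (lie_br X Y).
Proof.
move=> /in_spP [A [B [C [eB eC ->]]]] /in_spP [A' [B' [C' [eB' eC' ->]]]].
rewrite lie_spm; apply/in_spE.
by split; rewrite !(tr_sub, tr_add) !trmx_mul;
  do ?rewrite trmxK; rewrite ?eB ?eB' ?eC ?eC'; apply/matrixP => i j; rewrite !mxE; ring.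
Qed.

Lemma cartanE (a : 'rV[K]_r) : cartan a = spm (diag_mx a) 0 0.
Proof. by rewrite /cartan /spm tr_diag_mx. Qed.

Lemma in_sp_cartan (a : 'rV[K]_r) : in_sp (cartan a).
Proof. by rewrite cartanE; apply: in_sp_spm; rewrite trmx0. Qed.

Lemma unit_mxE (i j : 'I_r) : unit_mx K r i.+1 j.+1 = delta_mx i j.
Proof. by apply/matrixP => a b; rewrite !mxE. Qed.

Lemma tr_unit_mx i j : (unit_mx K r i j)^T = unit_mx K r j i.
Proof. by apply/matrixP => a b; rewrite !mxE andbC. Qed.

Lemma raisingE i : raising K r i =
  if i == r then spm 0 (unit_mx K r r r) 0 else spm (unit_mx K r i i.+1) 0 0.
Proof.
by rewrite /raising; case: eqP => _; rewrite /spm ?trmx0 ?oppr0 // tr_unit_mx.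
Qed.

Lemma in_sp_raising i : in_sp (raising K r i).
Proof. by rewrite raisingE; case: ifP => _; apply: in_sp_spm;
  rewrite ?trmx0 ?tr_unit_mx. Qed.

(** Transposition preserves sp and reverses brackets, so statements about raising operators carry
    over. *)
Definition lowering i := (raising K r i)^T.

Lemma in_sp_lowering i : in_sp (lowering i).
Proof. exact/in_sp_tr/in_sp_raising. Qed.

Section Generation.
Variable P : 'M[K]_(r + r) -> Prop.
Hypothesis Plin : forall a X Y, in_sp X -> in_sp Y -> P X -> P Y -> P (a *: X + Y).
Hypothesis Plie : forall X Y, in_sp X -> in_sp Y -> P X -> P Y -> P (lie_br X Y).
Hypothesis Praising : forall i, (1 <= i <= r)%N -> P (raising K r i).

Let Psp X := in_sp X /\ P X.

Let Psp_lin a X Y : Psp X -> Psp Y -> Psp (a *: X + Y).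
Proof. by case=> X1 X2 [Y1 Y2]; split; [apply: in_sp_lin | apply: Plin]. Qed.

Let Psp_lie X Y : Psp X -> Psp Y -> Psp (lie_br X Y).
Proof. by case=> X1 X2 [Y1 Y2]; split; [apply: in_sp_lie | apply: Plie]. Qed.

Lemma gen_upper_A (i j : 'I_r) : (i < j)%N -> Psp (spm (delta_mx i j) 0 0).
Proof.
case: j => j jr /=; elim: j jr => // j IH jr.
have jr' : (j < r)%N by apply: ltnW.
rewrite ltnS leq_eqVlt => /orP [/eqP ij|ij].
  have h : (1 <= j.+1 <= r)%N by apply: jr'.
  have := conj (in_sp_raising j.+1) (Praising h); rewrite raisingE (ltn_eqF jr).
  have -> : unit_mx K r j.+1 j.+2 = delta_mx i (Ordinal jr) by rewrite -unit_mxE /= ij.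
  by [].
have h1 := IH jr' ij.
have h : (1 <= j.+1 <= r)%N by apply: jr'.
have := conj (in_sp_raising j.+1) (Praising h); rewrite raisingE (ltn_eqF jr).
have -> : unit_mx K r j.+1 j.+2 = delta_mx (Ordinal jr') (Ordinal jr) by rewrite -unit_mxE.
move/(Psp_lie h1); rewrite lie_spm !(mulmx0, mul0mx, trmx0, addr0, subr0).
rewrite !trmx_delta !mul_delta_mx_cond eqxx mulr1n.
have -> : (Ordinal jr == i) = false by rewrite -val_eqE /= gtn_eqF // ltnW.
have -> : (i == Ordinal jr) = false by rewrite -val_eqE /= ltn_eqF // ltnW.
by rewrite !mulr0n !mulr1n subr0 !add0r /spm trmx_delta.
Qed.

(** Starting from the long root vector, brackets with the elements of [gen_upper_A] move one index
    at a time away from [r]. *)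
Lemma gen_upper_B (i j : 'I_r) : Psp (spm 0 (delta_mx i j + delta_mx j i) 0).
Proof.
have r0 : (0 < r)%N by apply: leq_ltn_trans (ltn_ord i).
have m : (r.-1 < r)%N by rewrite prednK.
pose o := Ordinal m.
have hr : (1 <= r <= r)%N by rewrite r0 leqnn.
have Poo : Psp (spm 0 (delta_mx o o) 0).
  have := conj (in_sp_raising r) (Praising hr); rewrite raisingE eqxx.
  by rewrite -(unit_mxE o o) /= prednK.
have lt_o (k : 'I_r) : k != o -> (k < o)%N.
  by move=> ko; have := ltn_ord k; move: ko; rewrite -val_eqE /=; move: r0; clear; lia.
have Psp2 (k : 'I_r) : Psp (spm 0 (delta_mx k o + delta_mx o k) 0).
  case: (eqVneq k o) => [->|ko].
    have := Psp_lin 1 Poo Poo.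
    by rewrite spm_lin !scaler0 !addr0 scale1r.
  have := Psp_lie (gen_upper_A (lt_o k ko)) Poo.
  rewrite lie_spm !(mulmx0, mul0mx, trmx0, addr0, subr0, sub0r, oppr0, add0r, opprK).
  by rewrite !trmx_delta !mul_delta_mx /spm trmx0 oppr0.
case: (eqVneq i o) => [->|io]; first by rewrite addrC.
case: (eqVneq j o) => [->|jo]; first by [].
have := Psp_lie (gen_upper_A (lt_o j jo)) (Psp2 i).
rewrite lie_spm !(mulmx0, mul0mx, trmx0, addr0, subr0, sub0r, oppr0, add0r, opprK).
rewrite !mulmxDr !mulmxDl !trmx_delta !mul_delta_mx_cond eqxx.
rewrite [o == i]eq_sym (negPf io) !mulr1n !mulr0n add0r addr0 /spm trmx0 oppr0.
by rewrite addrC.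
Qed.

End Generation.

Lemma sp_generation (P : 'M[K]_(r + r) -> Prop) :
  (forall a X Y, in_sp X -> in_sp Y -> P X -> P Y -> P (a *: X + Y)) ->
  (forall X Y, in_sp X -> in_sp Y -> P X -> P Y -> P (lie_br X Y)) ->
  (forall a, P (cartan a)) ->
  (forall i, (1 <= i <= r)%N -> P (raising K r i)) ->
  (forall i, (1 <= i <= r)%N -> P (lowering i)) ->
  forall X, in_sp X -> P X.
Proof.
move=> Plin Plie Pc Pe Pf.
(* The upper triangular results applied to [Q] give the lower triangular part. *)
pose Q X := P X^T.
have Qlin a X Y : in_sp X -> in_sp Y -> Q X -> Q Y -> Q (a *: X + Y).
  move=> Xs Ys QX QY; rewrite /Q linearD linearZ /=.
  by apply: Plin => //; apply: in_sp_tr.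
have Qlie X Y : in_sp X -> in_sp Y -> Q X -> Q Y -> Q (lie_br X Y).
  move=> Xs Ys QX QY; rewrite /Q /lie_br linearB /= !trmx_mul.
  by apply: Plie => //; apply: in_sp_tr.
have Qc a : Q (cartan a).
  by rewrite /Q cartanE tr_block_mx !trmx0 linearN /= trmxK tr_diag_mx -/(cartan a);
    apply: Pc.
have hA (i j : 'I_r) : P (spm (delta_mx i j) 0 0).
  case: (ltngtP i j) => [ij|ji|ij].
  - exact: (gen_upper_A Plie Pe ij).2.
  - have := (gen_upper_A Qlie Pf ji).2.
    by rewrite /Q tr_block_mx !trmx0 linearN /= trmxK /spm !trmx_delta.
  - have -> : j = i by apply: val_inj.
    have := Pc (delta_mx 0 i); rewrite cartanE; congr (P (spm _ _ _)).
    apply/matrixP => a b; rewrite !mxE eqxx /=.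
    case: (eqVneq a b) => [<-|ab]; first by rewrite andbb mulr1n.
    by rewrite mulr0n; case: (eqVneq a i) => [<-|] //=; rewrite eq_sym (negPf ab).
have hB i j : P (spm 0 (delta_mx i j + delta_mx j i) 0).
  exact: (gen_upper_B Plin Plie Pe i j).2.
have hC i j : P (spm 0 0 (delta_mx i j + delta_mx j i)).
  have := (gen_upper_B Qlin Qlie Pf i j).2.
  by rewrite /Q tr_block_mx !trmx0 oppr0 /spm trmx0 oppr0 linearD /= !trmx_delta addrC.
have P0 : P 0 by have := Pc 0; rewrite /cartan linear0 oppr0 block_mx0.
pose Psp X := in_sp X /\ P X.
have Plc (I : finType) (a : I -> K) (F : I -> 'M[K]_(r + r)) :
    (forall k, Psp (F k)) -> Psp (\sum_k a k *: F k).
  move=> hF; apply: (big_ind Psp); first by split=> //; apply: in_sp0.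
    move=> X Y [X1 X2] [Y1 Y2]; rewrite -[X]scale1r.
    by split; [apply: in_sp_lin | apply: Plin].
  move=> k _; have [F1 F2] := hF k; rewrite -[_ *: _]addr0.
  by split; [apply: in_sp_lin (in_sp0) | apply: Plin => //; apply: in_sp0].
move=> X /in_spP [A [B [C [eB eC ->]]]].
have spA i j : Psp (spm (delta_mx i j) 0 0).
  by split=> //; apply: in_sp_spm; rewrite trmx0.
have sym (i j : 'I_r) : (delta_mx i j + delta_mx j i)^T = delta_mx i j + delta_mx j i :> 'M[K]_r.
  by rewrite linearD /= !trmx_delta addrC.
have spB i j : Psp (spm 0 (delta_mx i j + delta_mx j i) 0).
  by split=> //; apply: in_sp_spm; rewrite ?trmx0 ?sym.
have spC i j : Psp (spm 0 0 (delta_mx i j + delta_mx j i)).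
  by split=> //; apply: in_sp_spm; rewrite ?trmx0 ?sym.
have half (D : 'M[K]_r) : D^T = D ->
    D = \sum_(k : 'I_r * 'I_r) (D k.1 k.2 / 2) *: (delta_mx k.1 k.2 + delta_mx k.2 k.1).
  move=> eD; apply: (scalerI (_ : 2 != 0)); first by rewrite pnatr_eq0.
  rewrite scaler_sumr -(pair_bigA _ (fun i j => 2 *: ((D i j / 2) *: (delta_mx i j + delta_mx j i)))) /=.
  rewrite scaler_nat mulr2n {1}[D]matrix_sum_delta -{2}eD {2}[D]matrix_sum_delta.
  rewrite linear_sum -big_split; apply: eq_bigr => i _ /=.
  rewrite linear_sum -big_split; apply: eq_bigr => j _ /=.
  by rewrite linearZ /= trmx_delta -scalerDr scalerA mulrCA divff ?mulr1 // pnatr_eq0.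
have [sA pA] := Plc _ (fun k : 'I_r * 'I_r => A k.1 k.2) _ (fun k => spA k.1 k.2).
have [sB pB] := Plc _ (fun k : 'I_r * 'I_r => B k.1 k.2 / 2) _ (fun k => spB k.1 k.2).
have [sC pC] := Plc _ (fun k : 'I_r * 'I_r => C k.1 k.2 / 2) _ (fun k => spC k.1 k.2).
have e1 (I : finType) (a : I -> K) (F G H : I -> 'M[K]_r) :
    \sum_k a k *: spm (F k) (G k) (H k) =
    spm (\sum_k a k *: F k) (\sum_k a k *: G k) (\sum_k a k *: H k).
  elim: (index_enum I) => [|k s IH]; first by rewrite !big_nil /spm trmx0 oppr0 block_mx0.
  by rewrite !big_cons IH spm_lin.
have z (I : finType) (a : I -> K) : \sum_k a k *: (0 : 'M[K]_r) = 0.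
  by apply: big1 => k _; rewrite scaler0.
rewrite !e1 !z in sA pA sB pB sC pC.
rewrite -(half B eB) in sB pB; rewrite -(half C eC) in sC pC.
have eA : \sum_(k : 'I_r * 'I_r) A k.1 k.2 *: delta_mx k.1 k.2 = A.
  by rewrite -(pair_bigA _ (fun i j => A i j *: delta_mx i j)) -matrix_sum_delta.
rewrite eA in sA pA.
have -> : spm A B C = 1 *: spm A 0 0 + (1 *: spm 0 B 0 + spm 0 0 C).
  by rewrite !spm_lin !scale1r !addr0 !add0r.
by apply: (Plin) => //; [apply: in_sp_lin | apply: Plin].
Qed.

End Symplectic.

(** * Chevalley relations in sp(2r) *)

Section ChevalleyRelations.
Variables (K : numFieldType) (r : nat).
Implicit Types (a : 'rV[K]_r) (u v : weight r) (i j : nat).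

Lemma weight_atD u v a : weight_at (u + v) a = weight_at u a + weight_at v a.
Proof.
by rewrite /weight_at -big_split; apply: eq_bigr => k _; rewrite mxE rmorphD mulrDl.
Qed.

Lemma weight_atN u a : weight_at (- u) a = - weight_at u a.
Proof.
by rewrite /weight_at -sumrN; apply: eq_bigr => k _; rewrite mxE rmorphN mulNr.
Qed.

Lemma weight_atB u v a : weight_at (u - v) a = weight_at u a - weight_at v a.
Proof. by rewrite weight_atD weight_atN. Qed.

Definition corow i : 'rV[K]_r := \row_k (scoroot r i 0 k)%:~R.

Lemma weight_at_corow u i : weight_at u (corow i) = (wdot u (scoroot r i))%:~R.
Proof.
by rewrite /weight_at /wdot rmorph_sum; apply: eq_bigr => k _; rewrite mxE rmorphM.
Qed.

Lemma weight_at_eps (k : 'I_r) a : weight_at (eps r k.+1) a = a 0 k.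
Proof.
rewrite /weight_at (bigD1 k) //= big1 => [|k' k'k]; rewrite !mxE.
  by rewrite eqxx mul1r addr0.
by move: k'k; rewrite -val_eqE eqSS => /negPf ->; rewrite mul0r.
Qed.

Lemma mul_diag_unit a i j :
  diag_mx a *m unit_mx K r i j = weight_at (eps r i) a *: unit_mx K r i j.
Proof.
apply/matrixP => x y; rewrite mul_diag_mx !mxE; case: (eqVneq x.+1 i) => [<-|_].
  by rewrite weight_at_eps.
by rewrite !mulr0.
Qed.

Lemma mul_unit_diag a i j :
  unit_mx K r i j *m diag_mx a = weight_at (eps r j) a *: unit_mx K r i j.
Proof. by rewrite -tr_unit_mx -[diag_mx a]tr_diag_mx -trmx_mul mul_diag_unit linearZ. Qed.

Lemma mul_unit_mx i j k l : unit_mx K r i j *m unit_mx K r k l =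
  ((j == k) && (0 < j <= r)%N)%:R *: unit_mx K r i l.
Proof.
apply/matrixP => x y; rewrite !mxE.
have [/andP [j0 jr]|jr] := boolP (0 < j <= r)%N; last first.
  rewrite andbF mul0r big1 // => m _; rewrite !mxE.
  have -> : (m.+1 == j) = false by move: (ltn_ord m) jr; clear; lia.
  by rewrite andbF mul0r.
have jr' : (j.-1 < r)%N by move: j0 jr; clear; lia.
rewrite (bigD1 (Ordinal jr')) //= big1 => [|m]; rewrite !mxE /=.
  rewrite prednK // eqxx andbT addr0; do 2?case: eqP => //=;
    rewrite ?mulr0 ?mul0r ?mulr1 //.
rewrite -val_eqE /= => mj; have -> : (m.+1 == j) = false by move: mj j0; clear; lia.
by rewrite andbF mul0r.
Qed.

Lemma diag_corow i : diag_mx (corow i) =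
  if i == r then unit_mx K r r r else unit_mx K r i i - unit_mx K r i.+1 i.+1.
Proof.
have ne (x y : 'I_r) k : x != y -> (x.+1 == k) && (y.+1 == k) = false.
  rewrite -val_eqE => xy; apply/negbTE; apply: contra xy => /andP [/eqP <-].
  by rewrite eqSS eq_sym.
apply/matrixP => x y; rewrite !mxE /scoroot; case: ifP => _; rewrite !mxE;
  case: (eqVneq x y) => [->|xy]; rewrite ?mulr1n ?mulr0n ?andbb ?ne ?subrr //.
- by rewrite rmorph_nat.
- by rewrite rmorphB !rmorph_nat.
Qed.

Lemma loweringE i : lowering K r i =
  if i == r then spm 0 0 (unit_mx K r r r) else spm (unit_mx K r i.+1 i) 0 0.
Proof.
by rewrite /lowering raisingE; case: ifP => _;
   rewrite tr_block_mx !trmx0 ?linearN /= ?trmx0 ?trmxK tr_unit_mx /spm ?trmx0 ?tr_unit_mx.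
Qed.

Lemma weight_at_sroot i a : weight_at (sroot r i) a =
  if i == r then weight_at (eps r r) a + weight_at (eps r r) a
  else weight_at (eps r i) a - weight_at (eps r i.+1) a.
Proof. by rewrite /sroot; case: ifP => _; rewrite ?mulr2n ?weight_atD ?weight_atN. Qed.

Lemma spmZ (b : K) (A B C : 'M[K]_r) : b *: spm A B C = spm (b *: A) (b *: B) (b *: C).
Proof. by rewrite /spm scale_block_mx linearZ /= scalerN. Qed.

Lemma lie_AA (A A' : 'M[K]_r) : lie_br (spm A 0 0) (spm A' 0 0) = spm (A *m A' - A' *m A) 0 0.
Proof.
rewrite lie_spm !(mulmx0, mul0mx) !addr0 !subr0 !add0r -!trmx_mul /spm tr_sub.
by rewrite opprB.
Qed.

Lemma lie_AB (A B : 'M[K]_r) : lie_br (spm A 0 0) (spm 0 B 0) = spm 0 (A *m B + B *m A^T) 0.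
Proof.
rewrite lie_spm !(mulmx0, mul0mx, trmx0) !(addr0, subr0, sub0r, opprK, oppr0).
by rewrite /spm trmx0 oppr0.
Qed.

Lemma lie_BC (B C : 'M[K]_r) : B^T = B -> C^T = C ->
  lie_br (spm 0 B 0) (spm 0 0 C) = spm (B *m C) 0 0.
Proof.
move=> eB eC; rewrite lie_spm !(mulmx0, mul0mx, trmx0) !(addr0, subr0, sub0r, add0r, oppr0).
by rewrite /spm trmx_mul eB eC.
Qed.

Lemma lie_AC (A C : 'M[K]_r) : lie_br (spm A 0 0) (spm 0 0 C) = spm 0 0 (- (A^T *m C + C *m A)).
Proof.
rewrite lie_spm !(mulmx0, mul0mx, trmx0) !(addr0, subr0, sub0r, add0r, oppr0).
by rewrite /spm trmx0 oppr0 opprD.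
Qed.

Lemma spm0 : spm 0 0 0 = 0 :> 'M[K]_(r + r).
Proof. by rewrite /spm trmx0 oppr0 block_mx0. Qed.

Lemma lie_brC n (X Y : 'M[K]_n) : lie_br X Y = - lie_br Y X.
Proof. by rewrite /lie_br opprB. Qed.

Lemma lie_tr n (X Y : 'M[K]_n) : lie_br X^T Y^T = - (lie_br X Y)^T.
Proof. by rewrite /lie_br tr_sub !trmx_mul opprB. Qed.

Lemma lie_cartan_raising a i :
  lie_br (cartan a) (raising K r i) = weight_at (sroot r i) a *: raising K r i.
Proof.
rewrite cartanE raisingE weight_at_sroot; case: ifP => _.
  by rewrite lie_AB tr_diag_mx mul_diag_unit mul_unit_diag spmZ !scaler0 scalerDl.
by rewrite lie_AA mul_diag_unit mul_unit_diag spmZ !scaler0 scalerBl.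
Qed.

Lemma lie_cartan_lowering a i :
  lie_br (cartan a) (lowering K r i) = - weight_at (sroot r i) a *: lowering K r i.
Proof.
have -> : cartan a = (cartan a)^T.
  by rewrite cartanE /spm tr_block_mx !trmx0 linearN /= trmxK tr_diag_mx.
by rewrite /lowering lie_tr lie_cartan_raising linearZ /= scaleNr.
Qed.

Lemma lie_raising_lowering i j : (1 <= i <= r)%N -> (1 <= j <= r)%N ->
  lie_br (raising K r i) (lowering K r j) = if i == j then cartan (corow i) else 0.
Proof.
move=> ir jr; rewrite raisingE loweringE cartanE diag_corow.
case: (eqVneq i r) => ei; case: (eqVneq j r) => ej.
- have rr : (0 < r <= r)%N by move: ir ei; clear; lia.
  by rewrite lie_BC ?tr_unit_mx // mul_unit_mx ei ej !eqxx rr scale1r.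
- rewrite ei [r == j]eq_sym (negPf ej) lie_brC lie_AB tr_unit_mx !mul_unit_mx.
  have -> : (j == r) = false by apply/negbTE.
  have -> : (r == j) = false by rewrite eq_sym; apply/negbTE.
  by rewrite !scale0r addr0 spm0 oppr0.
- rewrite ej (negPf ei) lie_AC tr_unit_mx !mul_unit_mx (negPf ei).
  have -> : (r == i) = false by rewrite eq_sym; apply/negbTE.
  by rewrite !scale0r addr0 oppr0 spm0.
rewrite lie_AA !mul_unit_mx eqSS.
case: (eqVneq i j) => [<-|ij]; last by rewrite !scale0r subrr spm0.
have -> : (0 < i.+1 <= r)%N by move: ei ir; clear; lia.
by rewrite ir !scale1r.
Qed.

End ChevalleyRelations.

(** * Modules and singular vectors *)

(** Irreducibility is about subspaces, while invariant sets arise below as predicates. Classically,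
    a subspace inside [S] is enlarged vector by vector until the dimension bounds the process. *)
Lemma vspace_of_pred (K : fieldType) (V : vectType K) (S : V -> Prop) :
  S 0 -> (forall a v w, S v -> S w -> S (a *: v + w)) ->
  exists U : {vspace V}, forall v, v \in U <-> S v.
Proof.
move=> S0 Sl.
suff h k (U : {vspace V}) : (forall v, v \in U -> S v) ->
    (\dim {:V} - \dim U <= k)%N -> exists U' : {vspace V}, forall v, v \in U' <-> S v.
  by apply: (h _ 0%VS _ (leqnn _)) => v; rewrite memv0 => /eqP ->.
elim: k U => [|k IH] U US.
  rewrite leqn0 subn_eq0 => dU; exists U => v; split; first exact: US.
  by move=> _; rewrite (_ : U = fullv) ?memvf //; apply/eqP; rewrite eqEdim subvf.
move=> dU; have [[v [Sv vU]]|nex] := EM (exists v, S v /\ v \notin U).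
  apply: (IH (U + <[v]>)%VS) => [w|].
    case/memv_addP => u uU [x /vlineP [b ->] ->].
    by rewrite addrC; apply: Sl => //; apply: US.
  have sU : (U <= U + <[v]>)%VS by apply: addvSl.
  have lt : (\dim U < \dim (U + <[v]>))%N.
    rewrite ltn_neqAle dimvS // andbT; apply: contra vU => /eqP e.
    have -> : U = (U + <[v]>)%VS by apply/eqP; rewrite eqEdim sU e leqnn.
    by rewrite (subvP (addvSr _ _)) // memv_line.
  by have := dimvS (subvf (U + <[v]>)); move: dU lt; clear; lia.
exists U => v; split=> [|Sv]; first exact: US.
by apply: contra_notT nex => vU; exists v.
Qed.

Section PartialSums.
Variables (K : numFieldType) (r : nat).
Implicit Types (u v : weight r) (i j : nat).

(** The pairing with the fundamental coweight [j] (with its double for [j = r]), which detects the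
    multiplicity of the simple root [j] in a difference of weights. *)
Definition psum u j : int := \sum_(m < r) u 0 m * (m < j)%:R.

Definition coweight j : 'rV[K]_r := \row_m (m < j)%:R.

Lemma weight_at_coweight u j : weight_at u (coweight j) = (psum u j)%:~R.
Proof.
by rewrite /weight_at /psum rmorph_sum; apply: eq_bigr => m _;
  rewrite mxE rmorphM rmorph_nat.
Qed.

Lemma psumD u v j : psum (u + v) j = psum u j + psum v j.
Proof. by rewrite /psum -big_split; apply: eq_bigr => m _; rewrite mxE mulrDl. Qed.

Lemma psumN u j : psum (- u) j = - psum u j.
Proof. by rewrite /psum -sumrN; apply: eq_bigr => m _; rewrite mxE mulNr. Qed.

Lemma psum0 j : psum 0 j = 0.
Proof. by rewrite /psum big1 // => m _; rewrite mxE mul0r. Qed.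

Lemma psum_eps i j : psum (eps r i) j = (0 < i <= minn j r)%:R.
Proof.
have [/andP [i0 ir]|ir] := boolP (0 < i <= r)%N; last first.
  rewrite /psum big1 => [|m _]; last first.
    by rewrite mxE (_ : (m.+1 == i) = false) ?mul0r //; move: (ltn_ord m) ir; clear; lia.
  by rewrite (_ : (0 < i <= minn j r)%N = false) //; move: ir; clear; lia.
have ir' : (i.-1 < r)%N by move: i0 ir; clear; lia.
rewrite /psum (bigD1 (Ordinal ir')) //= mxE /= prednK // eqxx mul1r big1 ?addr0 => [|m].
  by congr (_%:R); move: i0 ir; clear; lia.
rewrite -val_eqE /= mxE => mi.
by rewrite (_ : (m.+1 == i) = false) ?mul0r //; move: mi i0; clear; lia.
Qed.

Lemma psum_sroot i j : (1 <= i <= r)%N -> (1 <= j <= r)%N ->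
  psum (sroot r i) j = (i == j)%:R *+ (if i == r then 2 else 1).
Proof.
move=> ir jr; rewrite /sroot; case: (eqVneq i r) => ei.
  by rewrite mulr2n psumD !psum_eps !natz mulr2n; lia.
by rewrite psumD psumN !psum_eps !natz mulr1n; lia.
Qed.

End PartialSums.

Section Module.
Variables (K : numFieldType) (r n : nat) (rho : 'M[K]_(r + r) -> 'M[K]_n).
Hypothesis hmod : sp_module rho.
Implicit Types (X Y : 'M[K]_(r + r)) (v w : 'cV[K]_n) (a : 'rV[K]_r) (i j : nat).

Local Notation E i := (rho (raising K r i)).
Local Notation F i := (rho (lowering K r i)).
Local Notation H a := (rho (cartan a)).

Lemma rho_lin b X Y : in_sp X -> in_sp Y -> rho (b *: X + Y) = b *: rho X + rho Y.
Proof. exact: hmod.1. Qed.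

Lemma rho0 : rho 0 = 0.
Proof.
have := rho_lin (-1) (in_sp0 K r) (in_sp0 K r).
by rewrite scaler0 addr0 scaleN1r addNr.
Qed.

Lemma rhoZ b X : in_sp X -> rho (b *: X) = b *: rho X.
Proof. by move=> Xs; rewrite -[b *: X]addr0 rho_lin ?rho0 ?addr0 //; apply: in_sp0. Qed.

Lemma rho_comm X Y v : in_sp X -> in_sp Y ->
  rho X *m (rho Y *m v) = rho (lie_br X Y) *m v + rho Y *m (rho X *m v).
Proof. by move=> Xs Ys; rewrite hmod.2 // mulmxBl !mulmxA subrK. Qed.

Lemma cartan_lowering a i v :
  H a *m (F i *m v) = - weight_at (sroot r i) a *: (F i *m v) + F i *m (H a *m v).
Proof.
rewrite (rho_comm _ (in_sp_cartan a) (in_sp_lowering K r i)) lie_cartan_lowering.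
by rewrite (rhoZ _ (in_sp_lowering K r i)) scalemxAl.
Qed.

Lemma raising_lowering i j v : (1 <= i <= r)%N -> (1 <= j <= r)%N ->
  E i *m (F j *m v) = (if i == j then H (corow K r i) *m v else 0) + F j *m (E i *m v).
Proof.
move=> ir jr; rewrite (rho_comm _ (in_sp_raising K r i) (in_sp_lowering K r j)) lie_raising_lowering //.
by case: ifP => // _; rewrite rho0 mul0mx.
Qed.

Definition weight_vector (mu : weight r) v := forall a, H a *m v = weight_at mu a *: v.

Definition singular (mu : weight r) v :=
  (forall i, (1 <= i <= r)%N -> E i *m v = 0) /\ weight_vector mu v.

Lemma weight_vector_lowering mu i v :
  weight_vector mu v -> weight_vector (mu - sroot r i) (F i *m v).
Proof.
by move=> wv a; rewrite cartan_lowering wv -scalemxAr -scalerDl weight_atB addrC.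
Qed.

Hypothesis hirr : sp_irreducible rho.

(** By [sp_generation] the predicate cuts out a nonzero submodule. *)
Lemma irr_ind (S : 'cV[K]_n -> Prop) u : u != 0 -> S u ->
  (forall b v w, S v -> S w -> S (b *: v + w)) ->
  (forall i v, (1 <= i <= r)%N -> S v -> S (E i *m v)) ->
  (forall i v, (1 <= i <= r)%N -> S v -> S (F i *m v)) ->
  (forall a v, S v -> S (H a *m v)) ->
  forall v, S v.
Proof.
move=> u0 Su Sl SE SF SH.
have S0 : S 0 by have := Sl (-1) u u Su Su; rewrite scaleN1r addNr.
have SX X : in_sp X -> forall v, S v -> S (rho X *m v).
  move: X; apply: sp_generation => [b X Y Xs Ys hX hY|X Y Xs Ys hX hY||i ir|i ir] v.
  - move=> Sv; rewrite rho_lin // mulmxDl -scalemxAl.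
    by apply: Sl; [apply: hX | apply: hY].
  - move=> Sv; rewrite hmod.2 // mulmxBl -!mulmxA addrC -scaleN1r.
    by apply: Sl; [apply/hY/hX | apply/hX/hY].
  - by move=> w; apply: SH.
  - exact: SE.
  - exact: SF.
have [U hU] := vspace_of_pred S0 Sl.
have [_ /(_ U)] := hirr; case=> [X v Xs /hU Sv|e|e v].
- by apply/hU; apply: SX.
- by move/hU: Su; rewrite e memv0 (negPf u0).
- by apply/hU; rewrite e memvf.
Qed.

Inductive lowered (u : 'cV[K]_n) : 'cV[K]_n -> Prop :=
| lowered_base : lowered u u
| lowered_low i v : (1 <= i <= r)%N -> lowered u v -> lowered u (F i *m v)
| lowered_lin b v w : lowered u v -> lowered u w -> lowered u (b *: v + w).

(** Commuting raising operators past lowering ones until they reach [u] shows that the lowered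
    vectors form a submodule. *)
Lemma lowered_all mu u : u != 0 -> singular mu u -> forall v, lowered u v.
Proof.
move=> u0 [uE uH].
have L0 : lowered u 0.
  by have := lowered_lin (-1) (lowered_base u) (lowered_base u); rewrite scaleN1r addNr.
have LZ b v : lowered u v -> lowered u (b *: v).
  by move=> Lv; rewrite -[_ *: _]addr0; apply: lowered_lin.
have LH a v : lowered u v -> lowered u (H a *m v).
  elim=> [|i w ir Lw IH|b w w' Lw IH Lw' IH'].
  - by rewrite uH; apply/LZ/lowered_base.
  - by rewrite cartan_lowering; apply: lowered_lin; apply: lowered_low.
  - by rewrite mulmxDr -scalemxAr; apply: lowered_lin.
apply: (irr_ind u0 (lowered_base u)) => [b v w|i v ir|i v ir|a v].
- exact: lowered_lin.
- elim=> [|j w jr Lw IH|b w w' Lw IH Lw' IH'].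
  + by rewrite uE.
  + rewrite raising_lowering //; case: ifP => _; last by rewrite add0r;
    apply: lowered_low.
    rewrite -[H _ *m _]scale1r; apply: lowered_lin; first exact: LH.
    exact: lowered_low.
  + by rewrite mulmxDr -scalemxAr; apply: lowered_lin.
- exact: lowered_low.
- exact: LH.
Qed.

Section Eigenvalues.
Variables (M : 'M[K]_n) (c : nat -> K).

(** A finite product of the [M - c m] kills such a sum, so an eigenvector of this form has one of
    the [c m] as its eigenvalue. *)
Inductive eigensum : 'cV[K]_n -> Prop :=
| eigensum_base m v : M *m v = c m *: v -> eigensum v
| eigensum_add v w : eigensum v -> eigensum w -> eigensum (v + w).

Fixpoint annih N v := if N is N'.+1 then M *m annih N' v - c N' *: annih N' v else v.

Lemma annihD N v w : annih N (v + w) = annih N v + annih N w.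
Proof. by elim: N => //= N ->; rewrite mulmxDr scalerDr opprD addrACA. Qed.

Lemma annih_eigen N b v : M *m v = b *: v -> annih N v = (\prod_(m < N) (b - c m)) *: v.
Proof.
move=> e; elim: N => [|N /= ->]; first by rewrite big_ord0 scale1r.
by rewrite -scalemxAr e !scalerA -scalerBl big_ord_recr /= mulrBr [c N * _]mulrC.
Qed.

Lemma annih_le N N' v : (N <= N')%N -> annih N v = 0 -> annih N' v = 0.
Proof.
move=> le e; rewrite -(subnKC le); elim: (N' - N)%N => [|k IH]; first by rewrite addn0.
by rewrite addnS /= IH mulmx0 scaler0 subr0.
Qed.

Lemma eigensum_annih v : eigensum v -> exists N, annih N v = 0.
Proof.
elim=> [m w e|w w' _ [N e] _ [N' e']].
  by exists m.+1; rewrite (annih_eigen _ e) big_ord_recr /= subrr mulr0 scale0r.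
exists (maxn N N'); rewrite annihD.
by rewrite (annih_le (leq_maxl _ _) e) (annih_le (leq_maxr _ _) e') addr0.
Qed.

Lemma eigensum_eigenvalue b v : v != 0 -> M *m v = b *: v -> eigensum v -> exists m, b = c m.
Proof.
move=> v0 e /eigensum_annih [N]; rewrite (annih_eigen _ e) => /eqP.
rewrite scaler_eq0 (negPf v0) orbF prodf_seq_eq0 => /hasP [m _].
by rewrite /= subr_eq0 => /eqP ->; exists m.
Qed.

End Eigenvalues.

Lemma singular_dominates mu u nu x j : (1 <= j <= r)%N ->
  u != 0 -> singular mu u -> x != 0 -> weight_vector nu x -> psum nu j <= psum mu j.
Proof.
move=> jr u0 su x0 wx.
(* Every lowering operator subtracts 0, 1 or 2 from the eigenvalue of [coweight j], so only these
   values occur. *)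
pose c m : K := (psum mu j - m%:Z)%:~R.
have [] := @eigensum_eigenvalue (H (coweight K r j)) c (psum nu j)%:~R x x0.
- by rewrite wx weight_at_coweight.
- have := lowered_all u0 su x; elim=> [|i v ir _|b v w _ IHv _ IHw].
  + by apply: (@eigensum_base _ _ 0); rewrite su.2 weight_at_coweight /c subr0.
  + elim=> [m w e|w w' _ IH _ IH']; last by rewrite mulmxDr; apply: eigensum_add.
    pose s : nat := if i == j then (if i == r then 2 else 1) else 0.
    apply: (@eigensum_base _ _ (m + s)); rewrite cartan_lowering e -scalemxAr -scalerDl.
    rewrite weight_at_coweight psum_sroot // /c; congr (_ *: _).
    have -> : (i == j)%:R *+ (if i == r then 2 else 1) = s%:Z.
      by rewrite /s; case: (i == j); case: (i == r).
    by rewrite -rmorphN -rmorphD PoszD; congr (_%:~R); ring.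
  + apply: eigensum_add => //; elim: IHv => [m v' e|v1 v2 _ IH _ IH'].
      by apply: (@eigensum_base _ _ m); rewrite -scalemxAr e !scalerA mulrC.
    by rewrite scalerDr; apply: eigensum_add.
move=> m /eqP; rewrite /c eqr_int => /eqP ->.
by rewrite gerBl.
Qed.

Lemma singular_weight_unique mu u nu x j : (1 <= j <= r)%N ->
  u != 0 -> singular mu u -> x != 0 -> singular nu x -> psum nu j = psum mu j.
Proof.
move=> jr u0 su x0 sx; apply/eqP; rewrite eq_le.
rewrite (singular_dominates jr u0 su x0 sx.2).
by rewrite (singular_dominates jr x0 sx u0 su.2).
Qed.

End Module.

(** * The vector representation and admissible tuples *)

Section VectorChain.
Variable r : nat.
Hypothesis r2 : (2 <= r)%N.

(* The weights of the vector representation are numbered in the order [eps_1, ..,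
   eps_r, - eps_r, .., - eps_1], starting from 0; subtracting the simple root
   [chain_dir k.+1] leads from number [k] to number [k.+1]. *)
Definition chain_dir k := if (k <= r)%N then k else (2 * r - k)%N.

Definition chain_weight k : weight r :=
  if (k < r)%N then eps r k.+1 else - eps r (2 * r - k).

Lemma chain_dir_range k : (k.+1 < 2 * r)%N -> (1 <= chain_dir k.+1 <= r)%N.
Proof. by rewrite /chain_dir; case: (leqP k.+1 r); move: r2; clear; lia. Qed.

Lemma chain_dir_step k : (k < 2 * r)%N -> chain_dir k.+1 != chain_dir k.
Proof. by rewrite /chain_dir; case: (leqP k.+1 r); case: (leqP k r); clear; lia. Qed.

(** The value 0 is not a direction: it marks both ends of the chain, before the first vector and
    after the last. *)
Lemma chain_dir_last : chain_dir (2 * r) = 0%N.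
Proof. by rewrite /chain_dir; case: (leqP (2 * r) r); move: r2; clear; lia. Qed.

Lemma chain_weightS k : (k.+1 < 2 * r)%N ->
  chain_weight k.+1 = chain_weight k - sroot r (chain_dir k.+1).
Proof.
move=> kr; rewrite /chain_weight /chain_dir /sroot.
case: (ltngtP k.+1 r) => [k1|k1|k1].
- by rewrite ltn_eqF // opprB addrC subrK.
- have -> : (2 * r - k.+1 == r)%N = false by move: k1 kr; clear; lia.
  have -> : (2 * r - k = (2 * r - k.+1).+1)%N by move: kr; clear; lia.
  by rewrite opprB addKr.
- have -> : (2 * r - k.+1 = r)%N by move: k1; clear; lia.
  by rewrite k1 eqxx mulr2n opprD addrA subrr add0r.
Qed.

Lemma chain_weight_coroot k j : (k < 2 * r)%N -> (1 <= j <= r)%N ->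
  wdot (chain_weight k) (scoroot r j) = (j == chain_dir k.+1)%:R - (j == chain_dir k)%:R.
Proof.
move=> kr jr; rewrite /chain_weight /chain_dir /scoroot.
case: (eqVneq j r) => ej; case: (ltnP k r) => k1; case: (leqP k r) => k2;
  rewrite !(wdotNl, wdotDr, wdotNr, wdot_eps) !natz; lia.
Qed.

Lemma psum_chain_weight k j : (k < 2 * r)%N -> (1 <= j <= r)%N ->
  psum (chain_weight k) j =
  if (k < r)%N then (k < j)%:R else - (2 * r - k <= j)%:R.
Proof.
move=> kr jr; rewrite /chain_weight; case: ltnP => k1; rewrite ?psumN psum_eps.
  by congr (_%:R); move: jr k1; clear; lia.
by congr (- _%:R); move: kr jr k1; clear; lia.
Qed.

Lemma psum_chain_weight_le k j : (k < 2 * r)%N -> (1 <= j <= r)%N ->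
  psum (chain_weight k) j <= 1.
Proof.
by move=> kr jr; rewrite psum_chain_weight //; case: ltnP => _; rewrite natz; lia.
Qed.

Section Chain.
Variables (K : numFieldType) (n : nat) (rho : 'M[K]_(r + r) -> 'M[K]_n).
Hypotheses (hmod : sp_module rho) (hirr : sp_irreducible rho).
Variable w0 : 'cV[K]_n.
Hypotheses (w0_neq0 : w0 != 0) (w0_sing : singular rho (fweight r 1) w0).

Local Notation E i := (rho (raising K r i)).
Local Notation F i := (rho (lowering K r i)).
Local Notation H a := (rho (cartan a)).

Fixpoint chain k : 'cV[K]_n := if k is k'.+1 then F (chain_dir k) *m chain k' else w0.

Lemma fweight1 : fweight r 1 = eps r 1.
Proof. by rewrite /fweight big_nat1. Qed.

(* For [j] other than the next direction, [F j *m chain k] is singular of a weight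
   different from [omega_1], hence 0. *)
Lemma chainP k : (k < 2 * r)%N ->
  [/\ weight_vector rho (chain_weight k) (chain k),
      forall i, (1 <= i <= r)%N ->
        E i *m chain k = if i == chain_dir k then chain k.-1 else 0
    & forall j, (1 <= j <= r)%N -> j != chain_dir k.+1 -> F j *m chain k = 0].
Proof.
elim/ltn_ind: k => k IH kr.
have WE : weight_vector rho (chain_weight k) (chain k) /\
    (forall i, (1 <= i <= r)%N -> E i *m chain k = if i == chain_dir k then chain k.-1 else 0).
  case: k IH kr => [|k] IH kr.
    split; first by rewrite /chain_weight (ltnW r2) -fweight1; apply: w0_sing.2.
    by move=> i ir; rewrite /= w0_sing.1 // /chain_dir /=; case: i ir.
  have kr' : (k < 2 * r)%N by apply: ltnW.
  have [IW IE IF] := IH k (ltnSn k) kr'; split.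
    by rewrite chain_weightS //; apply: weight_vector_lowering.
  move=> i ir; rewrite /= (raising_lowering hmod) ?chain_dir_range // IE //.
  (* What survives of [E i] after passing the last [F] applies the new direction one vector too
     early; that vanishes because consecutive directions differ. *)
  have -> : F (chain_dir k.+1) *m (if i == chain_dir k then chain k.-1 else 0) = 0.
    case: eqP => ei; last by rewrite mulmx0.
    case: k IH kr kr' IW IE IF ei => [|k] IH kr kr' IW IE IF ei.
      by move: ir; rewrite ei.
    have [_ _ IF'] := IH k (ltnW (ltnSn k.+1)) (ltnW kr').
    by apply: IF'; [apply: chain_dir_range | apply: chain_dir_step].
  rewrite addr0; case: eqP => // ->.
  rewrite IW weight_at_corow chain_weight_coroot ?chain_dir_range // eqxx.
  by rewrite (negPf (chain_dir_step kr')) subr0 scale1r.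
have [W Ek] := WE; split=> // j jr jd.
apply/eqP; apply: contraT => v0.
have sv : singular rho (chain_weight k - sroot r j) (F j *m chain k).
  split; last by apply: weight_vector_lowering.
  move=> i ir; rewrite (raising_lowering hmod) // Ek // W weight_at_corow.
  rewrite chain_weight_coroot //.
  case: (eqVneq i j) => [->|ij].
    rewrite (negPf jd) sub0r; case: (eqVneq j (chain_dir k)) => [ej|_]; last first.
      by rewrite oppr0 scale0r mulmx0 addr0.
    case: k IH kr WE W Ek jd v0 ej => [|k] IH kr WE W Ek jd v0 ej; first by move: jr;
      rewrite ej.
    by rewrite scaleN1r /= -ej addNr.
  rewrite add0r; case: eqP => [ei|_]; last by rewrite mulmx0.
  case: k IH kr WE W Ek jd v0 ei => [|k] IH kr WE W Ek jd v0 ei; first by move: ir;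
    rewrite ei.
  have [_ _ IF] := IH k (ltnSn k) (ltnW kr).
  by apply: IF => //; rewrite -ei eq_sym.
(* Lowering in direction [j] brings the partial sum at [j] from at most 1 to at most 0, but for
   [omega_1] it is 1. *)
have := singular_weight_unique hmod hirr jr w0_neq0 w0_sing v0 sv.
rewrite fweight1 psumD psumN psum_sroot // eqxx psum_eps.
have -> : (0 < 1 <= minn j r)%N by move: jr; clear; lia.
by have := psum_chain_weight_le kr jr; case: (j == r); rewrite ?mulr1n ?mulr2n; lia.
Qed.

(** The coefficients are vectors of the other tensor factor. The raising operator of the last
    direction shifts the chain down, so the last coefficient vanishes by induction. *)
Lemma chain_independent n1 N (x : nat -> 'cV[K]_n1) : (N <= 2 * r)%N ->
  \sum_(k < N) x k *m (chain k)^T = 0 -> forall k, (k < N)%N -> x k = 0.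
Proof.
have last N' (y : nat -> 'cV[K]_n1) : (N' < 2 * r)%N ->
    \sum_(k < N'.+1) y k *m (chain k)^T = 0 -> y N' = 0.
  elim: N' y => [|N' IH] y Nr.
    rewrite big_ord1 /= => e; apply/matrixP => i j; rewrite ord1 [RHS]mxE.
    have [k wk] : exists k, w0 k 0 != 0.
      apply: contra_neqP w0_neq0 => h; apply/matrixP => k j'; rewrite ord1 [RHS]mxE.
      by apply: contra_notP h => /eqP wk; exists k.
    have := congr1 (fun A : 'M[K]_(n1, n) => A i k) e.
    rewrite !mxE big_ord1 !mxE => /eqP; rewrite mulf_eq0 (negPf wk) orbF.
    by move/eqP.
  move=> e; pose d := chain_dir N'.+1.
  have dr : (1 <= d <= r)%N by apply: chain_dir_range.
  pose y' k := if d == chain_dir k.+1 then y k.+1 else 0.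
  have := IH y' (ltnW Nr); rewrite /y' eqxx; apply.
  have := congr1 (fun A : 'M[K]_(n1, n) => A *m (E d)^T) e.
  rewrite mul0mx mulmx_suml big_ord_recl.
  have -> : y (@ord0 N'.+1) *m (chain (@ord0 N'.+1))^T *m (E d)^T = 0.
    by rewrite -mulmxA -trmx_mul /= w0_sing.1 // trmx0 mulmx0.
  rewrite add0r => e'; rewrite -[RHS]e'; apply: eq_bigr => k _.
  rewrite -mulmxA -trmx_mul lift0.
  have kr : (k.+1 < 2 * r)%N by apply: leq_ltn_trans Nr; rewrite ltnS; case: k.
  have [_ -> //] := chainP kr.
  by case: ifP => // _; rewrite mul0mx trmx0 mulmx0.
elim: N => [|N IH] Nr e k //; rewrite ltnS leq_eqVlt => /orP [/eqP ->|kN].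
  exact: last e.
have xN := last _ _ Nr e; apply: IH kN; first exact: ltnW.
by move: e; rewrite big_ord_recr /= xN mul0mx addr0.
Qed.

(** The span of the chain is stable under all generators. Coefficients beyond the end are 0, so that
    [x k.+1] makes sense for the last [k]. *)
Lemma chain_span m (A : 'M[K]_(m, n)) : exists x : nat -> 'cV[K]_m,
  (forall k, (2 * r <= k)%N -> x k = 0) /\ A = \sum_(k < 2 * r) x k *m (chain k)^T.
Proof.
pose W : 'M[K]_(2 * r, n) := \matrix_(k < 2 * r) (chain k)^T.
have rowW (k : 'I_(2 * r)) : row k W = (chain k)^T by rewrite rowK.
have chW k : (k < 2 * r)%N -> ((chain k)^T <= W)%MS.
  by move=> kr; rewrite -[k]/(val (Ordinal kr)) -rowW row_sub.
have stable (B : 'M[K]_n) : (forall k, (k < 2 * r)%N -> ((B *m chain k)^T <= W)%MS) ->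
    forall v : 'cV_n, (v^T <= W)%MS -> ((B *m v)^T <= W)%MS.
  move=> hB v vW; rewrite trmx_mul; apply: submx_trans (submxMr _ vW) _.
  by apply/row_subP => k; rewrite row_mul rowW -trmx_mul; apply: hB.
have full (v : 'cV_n) : (v^T <= W)%MS.
  move: v; apply: (irr_ind hmod hirr w0_neq0) => [|b v v' vW v'W|i v ir|i v ir|a v].
  - by apply: (chW 0%N); move: r2; clear; lia.
  - by rewrite linearD linearZ /= addmx_sub // scalemx_sub.
  - apply: stable => k kr; have [_ -> // _] := chainP kr.
    by case: ifP => _; rewrite ?trmx0 ?sub0mx // chW // (leq_ltn_trans (leq_pred _)).
  - apply: stable => k kr; have [_ _ Fk] := chainP kr.
    have [ed|nd] := eqVneq i (chain_dir k.+1); last by rewrite Fk // trmx0 sub0mx.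
    have k1 : (k.+1 < 2 * r)%N.
      rewrite ltn_neqAle kr andbT; apply/eqP => ek.
      by move: ir; rewrite ed ek chain_dir_last.
    by have := chW _ k1; rewrite /= -ed.
  - by apply: stable => k kr; have [-> _ _] := chainP kr;
    rewrite linearZ /= scalemx_sub // chW.
have /submxP [D eD] : (1%:M <= W)%MS.
  by apply/row_subP => i; rewrite -[row i _]trmxK; apply: full.
exists (fun k => if insub k is Some k' then col k' (A *m D) else 0); split.
  by move=> k kr; rewrite insubN // -leqNgt.
rewrite -[LHS]mulmx1 eD mulmxA; apply/matrixP => i j; rewrite summxE mxE.
by apply: eq_bigr => k _; rewrite valK !mxE big_ord1 !mxE; congr (_ * _).
Qed.

End Chain.

(** A pure tensor of [x] and [w] becomes the matrix [x *m w^T], and the second factor acts from the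
    right by transposes. *)
Definition mx_of_tensor (K : fieldType) n1 n2 (x : 'cV[K]_(n1 * n2)) : 'M[K]_(n1, n2) :=
  \matrix_(i, j) x (mxtens_index (i, j)) 0.

Lemma mx_of_tensor_act (K : fieldType) n1 n2 (A : 'M[K]_n1) (B : 'M[K]_n2) x :
  mx_of_tensor ((A *t 1%:M + 1%:M *t B) *m x) = A *m mx_of_tensor x + mx_of_tensor x *m B^T.
Proof.
apply/matrixP => i j; rewrite !mxE.
rewrite (reindex (@mxtens_index n1 n2)) /=; last first.
  by exists (@mxtens_unindex n1 n2) => k _;
    [apply: mxtens_indexK | apply: mxtens_unindexK].
rewrite (eq_bigr (fun p => (A i p.1 * (j == p.2)%:R + (i == p.1)%:R * B j p.2)
   * mx_of_tensor x p.1 p.2)); last first.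
  by case=> k l _; rewrite mxE !tensmxE !mxE.
rewrite -(pair_bigA _ (fun k l => (A i k * (j == l)%:R + (i == k)%:R * B j l)
   * mx_of_tensor x k l)) /=.
under eq_bigr => k _ do under eq_bigr => l _ do rewrite mulrDl.
under eq_bigr => k _ do rewrite big_split /=.
rewrite big_split /=; congr (_ + _).
  apply: eq_bigr => k _; rewrite (bigD1 j) //= eqxx mulr1 big1 ?addr0 // => l lj.
  by rewrite eq_sym (negPf lj) mulr0 mul0r.
rewrite (bigD1 i) //= eqxx [X in _ + X]big1 ?addr0 => [|k ki].
  by apply: eq_bigr => l _; rewrite mul1r [B^T _ _]mxE mulrC.
by apply: big1 => l _; rewrite eq_sym (negPf ki) !mul0r.
Qed.

Lemma mx_of_tensor_eq0 (K : fieldType) n1 n2 (x : 'cV[K]_(n1 * n2)) :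
  mx_of_tensor x = 0 -> x = 0.
Proof.
move=> e; apply/matrixP => k j; rewrite ord1 [RHS]mxE; case: (mxtens_indexP k) => i l.
by have := congr1 (fun A : 'M[K]_(n1, n2) => A i l) e; rewrite !mxE.
Qed.

(* If [sum_k x_k (x) w_k] is singular in the tensor product, [w_k] being the chain
   above, then the last nonzero [x_k] is singular. *)
Lemma summand_psum (K : numFieldType) (mu lam : weight r) :
  V_summand K mu lam (fweight r 1) -> exists2 k, (k < 2 * r)%N &
  forall j, (1 <= j <= r)%N -> psum mu j = psum lam j + psum (chain_weight k) j.
Proof.
case=> n1 [n2 [m [rho1 [rho2 [sigma [V1 V2 Vm [inj [proj [pi injP projP]]]]]]]]].
have [mod1 irr1 [v1 [v10 v1E v1H]]] := V1.
have [mod2 irr2 [w0 [w00 w0E w0H]]] := V2.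
have [modm irrm [u [u0 uE uH]]] := Vm.
have s1 : singular rho1 lam v1 by split.
have s2 : singular rho2 (fweight r 1) w0 by split.
pose M := mx_of_tensor (inj *m u).
have act X : in_sp X -> mx_of_tensor (inj *m (sigma X *m u)) = rho1 X *m M + M *m (rho2 X)^T.
  by move=> Xs; rewrite mulmxA -injP // -mulmxA mx_of_tensor_act.
have M0 : M != 0.
  apply: contra_neq u0 => /mx_of_tensor_eq0 e.
  by rewrite -[u]mul1mx -pi -mulmxA e mulmx0.
have [x [x0 eM]] := chain_span mod2 irr2 w00 s2 M.
have ME i : (1 <= i <= r)%N -> rho1 (raising K r i) *m M + M *m (rho2 (raising K r i))^T = 0.
  move=> ir; rewrite -act; last exact: in_sp_raising.
  by rewrite uE // mulmx0; apply/matrixP => a b; rewrite !mxE.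
have MH a : rho1 (cartan a) *m M + M *m (rho2 (cartan a))^T = weight_at mu a *: M.
  rewrite -act; last exact: in_sp_cartan.
  by rewrite uH -scalemxAr; apply/matrixP => i j; rewrite !mxE.
have r20 : (2 * r = (2 * r).-1.+1)%N by move: r2; clear; lia.
(* The coefficient of [chain k] in the image under [E i]: the second term arises because [E i] takes
   [chain k.+1] back to [chain k]. *)
have xE i k : (1 <= i <= r)%N -> (k < 2 * r)%N ->
    rho1 (raising K r i) *m x k + (if i == chain_dir k.+1 then x k.+1 else 0) = 0.
  move=> ir; move: k; apply: (chain_independent mod2 irr2 w00 s2 (leqnn _)).
  rewrite -[RHS](ME i ir) eM mulmx_sumr mulmx_suml.
  under eq_bigr => k _ do rewrite mulmxDl.
  rewrite big_split /=; congr (_ + _); first by apply: eq_bigr => k _; rewrite mulmxA.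
  rewrite [in LHS]r20 [in RHS]r20 big_ord_recr big_ord_recl /=.
  rewrite -r20 x0 // -!mulmxA -trmx_mul w0E // trmx0 mulmx0 add0r.
  have -> : (if i == chain_dir (2 * r) then 0 else 0 : 'cV[K]_n1) = 0 by case: ifP.
  rewrite mul0mx addr0; apply: eq_bigr => k _.
  rewrite -[bump 0 k]/(k.+1) -[_ *m chain rho2 w0 _]/(chain rho2 w0 k.+1) -mulmxA -trmx_mul.
  have kr : (k.+1 < 2 * r)%N by rewrite [X in (_ < X)%N]r20 ltnS.
  have [_ -> // _] := chainP mod2 irr2 w00 s2 kr.
  by case: ifP => _; rewrite ?trmx0 ?mul0mx ?mulmx0.
have xH a k : (k < 2 * r)%N -> rho1 (cartan a) *m x k =
    weight_at (mu - chain_weight k) a *: x k.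
  move=> kr; apply/eqP; rewrite -subr_eq0; apply/eqP; move: k kr.
  apply: (chain_independent mod2 irr2 w00 s2 (leqnn _)).
  transitivity (rho1 (cartan a) *m M + M *m (rho2 (cartan a))^T - weight_at mu a *: M);
    last first.
    by rewrite MH subrr.
  rewrite eM mulmx_sumr mulmx_suml scaler_sumr -big_split -sumrB;
    apply: eq_bigr => k _ /=.
  rewrite -mulmxA -trmx_mul; have [-> // _ _] := chainP mod2 irr2 w00 s2 (ltn_ord k).
  rewrite [(_ *: _)^T]linearZ /= -scalemxAr weight_atB mulmxBl scalerBl mulmxBl.
  by rewrite -!scalemxAl mulmxA opprB addrA.
have [k [kr xk xk1]] : exists k, [/\ (k < 2 * r)%N, x k != 0 & x k.+1 = 0].
  have [k kr xk] : exists2 k, (k < 2 * r)%N & x k != 0.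
    apply: contra_neqP M0 => h; rewrite eM big1 // => k _.
    have -> : x k = 0 by apply: contra_notP h => /eqP xk; exists k.
    by rewrite mul0mx.
  have ex : exists k, x k != 0 by exists k.
  have bd k' : x k' != 0 -> (k' <= 2 * r)%N.
    by move=> xk'; rewrite leqNgt; apply: contra xk' => kr'; rewrite x0 // ltnW.
  case: (ex_maxnP ex bd) => k' xk' max; exists k'; split=> //.
    by rewrite ltnNge; apply: contra xk' => kr'; rewrite x0.
  by apply/eqP; apply: contraT => /max; rewrite ltnn.
have sx : singular rho1 (mu - chain_weight k) (x k).
  split=> [i ir|a]; last exact: xH.
  by have := xE i k ir kr; rewrite xk1 if_same addr0.
exists k => // j jr.
have := singular_weight_unique mod1 irr1 jr v10 s1 xk sx.
by rewrite psumD psumN => /eqP; rewrite subr_eq => /eqP.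
Qed.

(** Only the simple root [j] contributes to the partial sum at [j], which thus isolates [l j]: it is
    1 minus the partial sum of the chain weight, halved for [j = r]. *)
Lemma admissible_shape (K : numFieldType) (lam : weight r) (l : nat -> nat) :
  admissible K lam l -> exists2 k, (k < 2 * r)%N &
  forall j, (1 <= j <= r)%N -> l j =
    if (k < r)%N then (j <= k)%N : nat
    else if j == r then 1%N else (1 + (2 * r - k <= j)%N)%N.
Proof.
move=> /summand_psum [k kr h]; exists k => // j jr.
have := h j jr; rewrite psumD psumD psumN.
have -> : psum (\sum_(1 <= i < r.+1) sroot r i *+ l i) j =
    (l j)%:Z *+ (if j == r then 2 else 1).
  rewrite (big_morph (fun u => psum u j) (fun u v => psumD u v j) (psum0 r j)).
  have e i : psum (sroot r i *+ l i) j = psum (sroot r i) j *+ l i.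
    by elim: (l i) => [|m IH]; rewrite ?mulr0n ?psum0 // !mulrS psumD IH.
  rewrite (bigD1_seq j) ?mem_index_iota ?iota_uniq //= big_seq_cond big1 => [|i].
    by rewrite e psum_sroot // eqxx addr0 mulrnAC mulr1n natz.
  by rewrite mem_index_iota => /andP [ir ij]; rewrite e psum_sroot // (negPf ij) !mul0rn.
rewrite fweight1 psum_eps psum_chain_weight // !natz.
by case: (ltnP k r) => k1; case: (eqVneq j r) => ej; rewrite ?mulr1n ?mulr2n; lia.
Qed.

End VectorChain.

(** * From admissibility and the Bethe equations to the operator *)

Lemma eq_Dop (K : fieldType) r (lam : weight r) (y y' : nat -> ratfun K) :
  (forall i, (1 <= i <= r)%N -> y i = y' i) -> Dop lam y = Dop lam y'.
Proof. by move=> e; rewrite !DopE; apply: eq_mop. Qed.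

Lemma admissible_length r (l : nat -> nat) k : (2 <= r)%N -> (k < 2 * r)%N ->
  (forall j, (1 <= j <= r)%N -> l j =
    if (k < r)%N then (j <= k)%N : nat
    else if j == r then 1%N else (1 + (2 * r - k <= j)%N)%N) ->
  tuple_length r l = k.
Proof.
move=> r2 kr h; rewrite /tuple_length (eq_big_nat _ _ (fun j (jr : (1 <= j < r.+1)%N) => h j jr)).
have count m n : (\sum_(1 <= j < n.+1) (j <= m)%N = minn m n)%N.
  elim: n => [|n IH]; first by rewrite big_geq // minn0.
  by rewrite big_nat_recr //= IH; clear; lia.
have [k1|k1] := ltnP k r; first by rewrite count; apply/minn_idPl/ltnW.
have count' m n : (0 < m)%N -> (\sum_(1 <= j < n.+1) (1 + (m <= j)) = n + (n.+1 - m))%N.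
  move=> m0; elim: n => [|n IH]; first by rewrite big_geq //; move: m0; clear; lia.
  by rewrite big_nat_recr //= IH; clear; lia.
have r0 : (0 < r)%N by apply: ltnW.
rewrite big_nat_recr //= eqxx.
have -> : (\sum_(1 <= j < r) (if j == r then 1 else 1 + (2 * r - k <= j)) =
    \sum_(1 <= j < r) (1 + (2 * r - k <= j)))%N.
  by apply: eq_big_nat => j /andP [_ jr]; rewrite (ltn_eqF jr).
have := count' (2 * r - k)%N r.-1; rewrite prednK // => ->; move: kr k1 r2; clear; lia.
Qed.

Theorem proposition5p3 (R : realType) (r : nat) (hr : (3 <= r)%N)
    (lam : weight r) (hlam : dominant lam)
    (l : nat -> nat) (hl : admissible R[i] lam l)
    (c : 'I_(tuple_length r l) -> nat) (hc : coloring c)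
    (t : 'I_(tuple_length r l) -> R[i])
    (ht : bethe_solution (tnth [tuple lam; fweight r 1])
            (tnth [tuple 0; 1]) c t) :
  Dop lam (fun i : nat => FracField.tofrac (bethe_poly c t i))
  = Dop lam (fun i : nat => ratX R[i] ^+ expo lam (tuple_length r l) i).
Proof.
have r2 : (2 <= r)%N by apply: ltnW.
pose Y := btuple c t.
have gY : good Y by split=> // j; apply: btuple_neq0.
have eqD (Y1 Y2 : nat -> {poly R[i]}) : (forall i, (1 <= i <= r)%N -> Y1 i = Y2 i) -> DY lam Y1 = DY lam Y2.
  exact: eq_DY.
have repro (Y1 : nat -> {poly R[i]}) i z kappa : (1 <= i <= r)%N -> good Y1 -> z != 0 -> kappa != 0 ->
    Y1 i * z^`() - (Y1 i)^`() * z = kappa *: ('X^(label lam i) * nbr r Y1 i) ->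
    DY lam Y1 = DY lam (upd Y1 i z).
  by move=> ir [Y10 Y100] z0 k0; apply: DY_reproduce.
have bY j : (1 <= j <= r)%N -> bethe_at (label lam j) (Y j) (nbr r Y j).
  exact: btuple_bethe_at.
have [k kr hk] := admissible_shape r2 hl.
have ek := admissible_length r2 kr hk.
suff e : DY lam Y = DY lam (fun j => 'X^(expo lam k j)).
  (* [Y] differs from the Bethe polynomials at most outside the indices 1 to [r], where the operator
     does not look. *)
  transitivity (DY lam Y).
    by apply: eq_Dop => i /andP [i1 _]; rewrite /Y /btuple gtn_eqF.
  by rewrite e ek; apply: eq_Dop => i _; rewrite tofracXn.
have [k1|k1] := ltnP k r.
  apply: (descent_short eqD repro k1 gY) => j jk.
  - have jr : (1 <= j <= r)%N by move: jk k1; clear; lia.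
    by apply: (btuple_shape1 t hc jr); rewrite hk // k1; case/andP: jk => _ ->.
  - have jr : (1 <= j <= r)%N by move: jk; clear; lia.
    by apply: (btuple_shape0 t hc jr); rewrite hk // k1 leqNgt; case/andP: jk => ->.
  - by apply: bY; move: jk k1; clear; lia.
(* A tuple of length [k >= r] has [2 * r - 1 - k] ones in front. *)
have k2 : (2 * r - 1 - k < r)%N by move: k1 r2; clear; lia.
have -> : k = (2 * r - 1 - (2 * r - 1 - k))%N by move: kr; clear; lia.
apply: (descent_long eqD repro k2 gY) => [j jk||].
- have [jr j2 j3] : [/\ (1 <= j <= r)%N, (j == r) = false & (2 * r - k <= j)%N = false].
    by split; move: jk k2 kr; clear; lia.
  by apply: (btuple_shape1 t hc jr); rewrite hk // ltnNge k1 j2 j3.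
- split=> [j jk|].
    have [jr j2 j3] : [/\ (1 <= j <= r)%N, (j == r) = false & (2 * r - k <= j)%N].
      by split; move: jk k2 kr; clear; lia.
    by apply: (btuple_shape2 hc ht jr); rewrite hk // ltnNge k1 j2 j3.
  have rr : (1 <= r <= r)%N by move: r2; clear; lia.
  by apply: (btuple_shape1 t hc rr); rewrite hk // ltnNge k1 eqxx.
exact: bY.
Qed.
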